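(* Let $F_{\Psi}:\mathcal{R}\to\mathcal{R}$ be the $\Psi$-lift of an expanding interval map $F$. Then the recurrent set $\mathbf{R}$ and the uniformly recurrent set $\mathbf{R}_u$ satisfy $$\dim_H(\mathbf{R})=\dim_H(\mathbf{R}_u)=\delta_0 ,$$ where $\delta_0$ is the $\alpha$-Poincaré exponent $\delta_\alpha$ for $\alpha=0$.
   Context: Setting. Let $I=\{1,\dots,m\}$, $m\ge 2$, and let $I_i\subset[0,1]$, $i\in I$, be pairwise disjoint intervals with non-empty interior. $F$ is an expanding interval map with $C^{1+\epsilon}$ full branches $F|_{I_i}:I_i\to[0,1]$: the continuous continuation $H_i$ of $F|_{I_i}$ to $\overline{I_i}$ is a $C^{1+\epsilon}$ diffeomorphism of $\overline{I_i}$ onto $[0,1]$ with $|H_i'|>1$. Put $h_i=H_i^{-1}:[0,1]\to\overline{I_i}$. Let $\Sigma=I^{\mathbb{N}}$ with left shift $\sigma$ and metric $d(\omega,\tau)=\exp(-\max\{k\ge0:\omega_1=\tau_1,\dots,\omega_k=\tau_k\})$, and let $\pi:\Sigma\to[0,1]$ be the coding map, $\{\pi(\omega)\}=\bigcap_{n}h_{\omega_1}\circ\cdots\circ h_{\omega_n}([0,1])$. Let $I^\star$ be the set of all finite words over $I$ (including the empty word), $|\omega|$ the length of $\omega\in I^\star$, and $[\omega]=\{x\in\Sigma: x|_{|\omega|}=\omega\}$ the cylinder of $\omega$. Let $\mathcal{D}=\bigcup_{(\omega_1,\dots,\omega_n)\in I^\star}h_{\omega_1}\circ\cdots\circ h_{\omega_n}(\{0,1\})$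 (the empty word contributing $\{0,1\}$) and $\mathcal{R}=(\pi(\Sigma)\setminus\mathcal{D})+\mathbb{Z}\subset\mathbb{R}$. Let $\Psi:[0,1]\to\mathbb{Z}$ be constant on each $I_i$. The $\Psi$-lift of $F$ is $F_\Psi:\mathcal{R}\to\mathcal{R}$, $F_\Psi(x)=\sum_{k\in\mathbb{Z}}\big(k+F(x-k)+\Psi(x-k)\big)\mathbf{1}_{[0,1]}(x-k)$. For $f:\Sigma\to\mathbb{R}$ put $S_nf=\sum_{k=0}^{n-1}f\circ\sigma^k$ and, for $\omega\in I^\star$, $S_\omega f=\sup_{x\in[\omega]}S_{|\omega|}f(x)$. The geometric potential $\varphi:\Sigma\to(-\infty,0)$ is the Hölder continuous function with $\varphi(\omega)=-\log|F'(\pi(\omega))|$ except possibly on a finite set (i.e. $\varphi(\omega)=-\log|H_{\omega_1}'(\pi(\omega))|$). The symbolic step length function $\psi:\Sigma\to\mathbb{Z}$ is constant on one-cylinder sets and equals $\Psi\circ\pi$ except possibly on a finite set (i.e. $\psi(\omega)$ is the value of $\Psi$ on $I_{\omega_1}$). For $\alpha\in\mathbb{R}$ the $\alpha$-Poincaré exponent is $$\delta_\alpha=\inf\Big\{s\ge0:\ \sum_{\omega\in I^\star,\ |S_\omega(\psi-\alpha)|\le K}e^{s\,S_\omega\varphi}<\infty\Big\},$$ where $K>0$ is sufficiently large. Recurrent set: $\mathbf{R}=\{x\in\mathcal{R}:\exists K\in\mathbb{R}\text{ such that }|F_\Psi^n(x)|\le K\text{ for infinitely many }n\in\mathbb{N}\}$.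 Uniformly recurrent set: $\mathbf{R}_u=\{x\in\mathcal{R}:\exists K\in\mathbb{R}\ \forall n\in\mathbb{N}\ |F_\Psi^n(x)|\le K\}$. $\dim_H$ is Hausdorff dimension, with $\dim_H\emptyset=0$. *)

(* Defs.v *)
From mathcomp Require Import all_boot all_order all_algebra.
From mathcomp Require Import all_classical all_reals all_analysis.
Import Order.TTheory GRing.Theory Num.Theory.
Import numFieldNormedType.Exports.

Set Implicit Arguments.
Unset Strict Implicit.
Unset Printing Implicit Defensive.

Local Open Scope classical_set_scope.
Local Open Scope ring_scope.

Section HausdorffDimension.
Context {R : realType}.
Implicit Types (U A : set R) (s d : R).

Definition diameter U : \bar R :=
  ereal_sup [set `|p.1 - p.2|%:E | p in U `*` U].

(* The empty set has weight 0 for every s, also for s = 0. *)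
Definition diameter_pow s U : \bar R :=
  if `[< U = set0 >] then 0%E else (diameter U `^ s)%E.

Definition hausdorff_premeasure s d A : \bar R :=
  ereal_inf [set (\sum_(0 <= n <oo) diameter_pow s (U n))%E |
    U in [set U : (set R)^nat |
      A `<=` \bigcup_n U n /\ forall n, (diameter (U n) <= d%:E)%E]].

Definition hausdorff_measure s A : \bar R :=
  ereal_sup [set hausdorff_premeasure s d A | d in [set d | 0 < d]].

Definition hausdorff_dim A : \bar R :=
  ereal_inf [set s%:E | s in
    [set s | 0 <= s /\ hausdorff_measure s A = 0%E]].

End HausdorffDimension.

Section Smoothness.
Context {R : realType}.
Implicit Types (A B : set R) (f : R -> R) (x : R).

(* Difference quotients restricted to A: at the end points of a closed
   interval A this is the one-sided derivative. *)
Definition quotient_within A f x : set_system R :=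
  (f y - f x) / (y - x) @[y --> within A x^'].

Definition derive_within A f x : R := lim (quotient_within A f x).

Definition C1_holder (eps : R) A f : Prop :=
  (forall x, A x -> cvg (quotient_within A f x)) /\
  exists C : R, forall x y, A x -> A y ->
    `|derive_within A f x - derive_within A f y| <= C * `|x - y| `^ eps.

Definition inverse_on A f : R -> R := 'pinv_(fun=> 0) A f.

Definition C1_holder_diffeo (eps : R) A B f : Prop :=
  [/\ set_bij A B f, C1_holder eps A f & C1_holder eps B (inverse_on A f)].

End Smoothness.

(* F is only constrained, and only used, on the union of the branch domains
   J i; H i is the continuous extension of F|_(J i) to closure (J i), and its
   values outside closure (J i) are irrelevant. *)
Record expanding_interval_map (R : realType) (m : nat) (eps : R)
    (J : 'I_m -> set R) (F : R -> R) (H : 'I_m -> R -> R) : Prop := {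
  branches_ge2 : (2 <= m)%N ;
  holder_exponent : 0 < eps <= 1 ;
  domain_interval : forall i, is_interval (J i) ;
  domain_sub : forall i, J i `<=` `[0, 1] ;
  domain_interior : forall i, (J i)° !=set0 ;
  domain_disjoint : trivIset setT J ;
  branch_eq : forall i x, J i x -> H i x = F x ;
  branch_continuous : forall i, {within closure (J i), continuous (H i)} ;
  branch_diffeo : forall i,
    C1_holder_diffeo eps (closure (J i)) `[0, 1] (H i) ;
  branch_expanding : forall i x, closure (J i) x ->
    1 < `|derive_within (closure (J i)) (H i) x| }.

Section SymbolicSpace.
Context {R : realType} {m : nat}.

Definition shift (w : nat -> 'I_m) : nat -> 'I_m := fun k => w k.+1.

Definition cylinder (u : seq 'I_m) : set (nat -> 'I_m) :=
  [set w | mkseq w (size u) = u].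

Definition birkhoff_sum (f : (nat -> 'I_m) -> R) (n : nat)
    (w : nat -> 'I_m) : R :=
  \sum_(0 <= k < n) f (iter k shift w).

Definition word_sum (f : (nat -> 'I_m) -> R) (u : seq 'I_m) : R :=
  sup [set birkhoff_sum f (size u) w | w in cylinder u].

End SymbolicSpace.

Section Lift.
Context {R : realType} {m : nat}.
Variables (J : 'I_m -> set R) (H : 'I_m -> R -> R).
Variables (F : R -> R) (Psi : R -> int).

Definition inverse_branch (i : 'I_m) : R -> R :=
  inverse_on (closure (J i)) (H i).

(* foldr composes from the left: [:: i1; ...; in] gives h_i1 \o ... \o h_in. *)
Definition word_map (u : seq 'I_m) (x : R) : R := foldr inverse_branch x u.

Definition coding (w : nat -> 'I_m) : R :=
  get (\bigcap_n (word_map (mkseq w n) @` `[0, 1])).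

Definition exceptional_points : set R :=
  \bigcup_u (word_map u @` [set 0; 1]).

Definition lift_domain : set R :=
  [set p.1 + p.2%:~R |
    p in (range coding `\` exceptional_points) `*` [set: int]].

Definition psi_lift (x : R) : R :=
  \sum_(k \in [set: int])
    (k%:~R + F (x - k%:~R) + (Psi (x - k%:~R))%:~R) *
      \1_`[0, 1] (x - k%:~R).

Definition recurrent_set : set R :=
  [set x | lift_domain x /\
    exists K : R, infinite_set [set n | `|iter n psi_lift x| <= K]].

Definition uniformly_recurrent_set : set R :=
  [set x | lift_domain x /\ exists K : R, forall n, `|iter n psi_lift x| <= K].

Definition geometric_potential (w : nat -> 'I_m) : R :=
  - ln `|derive_within (closure (J (w 0%N))) (H (w 0%N)) (coding w)|.

(* The value of Psi on J (w 0), read off at an arbitrary point of J (w 0). *)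
Definition step_length (w : nat -> 'I_m) : int := Psi (get (J (w 0%N))).

Definition centered_step (alpha : R) (w : nat -> 'I_m) : R :=
  (step_length w)%:~R - alpha.

Definition poincare_exponent (alpha K : R) : \bar R :=
  ereal_inf [set s%:E | s in [set s | 0 <= s /\
    (\esum_(u in [set u | `|word_sum (centered_step alpha) u| <= K]%R)
       (expR (s * word_sum geometric_potential u))%:E < +oo)%E]].

End Lift.

(* Main.v *)
(** The displacement of the lift along an itinerary is the sum of the step
    lengths of its letters. A recurrent point has bounded displacement
    infinitely often, so by pigeonhole some shift of its itinerary has
    infinitely many prefixes of total step 0; by bounded distortion the
    cylinders of such words have diameters comparable to exp (S_w phi), and the
    convergence of the Poincare series makes this limsup set null.

    Conversely, below the exponent the series over words of total step 0
    already diverges: a word of total step j is either completed to a word of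
    total step 0 by one of finitely many suffixes, or all steps have one sign
    and the word factors into few words of total step 0. Hence the sum of
    exp (s S_w phi) over the words w of total step 0 and length n is unbounded
    in n. For large n, following each such w by a fixed word of total step 0
    whose branch maps [0,1] into ]0,1[ gives a strongly separated iterated
    function system. Its limit set consists of uniformly recurrent points and
    has positive s-dimensional measure: given a cover of small total weight one
    descends, one block at a time, to a point that is not covered. *)

Require Import Defs.
From mathcomp Require Import finmap.
From mathcomp Require Import all_boot all_order all_algebra.
From mathcomp Require Import all_classical all_reals all_analysis.
From mathcomp Require Import zify ring lra.
Import Order.TTheory GRing.Theory Num.Theory.
Import numFieldNormedType.Exports.
Local Open Scope classical_set_scope.
Local Open Scope ring_scope.

(** * Greedy descent in a separated system of contractions *)

Definition scons {T : Type} (a : T) (t : nat -> T) : nat -> T :=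
  fun k => if k is k'.+1 then t k' else a.

Section Moran.
Set Implicit Arguments.
Unset Strict Implicit.
Context {R : realType} {T : finType}.
Implicit Types (t : nat -> T) (A : nat -> set (nat -> T)) (r c : nat -> R).

Context (rho : T -> R) (pt : (nat -> T) -> R) (r0 theta s : R).

(** Here [A k] is the set of codes of points in the [k]-th covering set, [r k] bounds its diameter
    and [c k] is its weight. A total below [r0 ^ s] forces every nonempty set to be shorter than the
    gap [r0]. The weight is bounded below only for nonempty [A k], so that a pull-back may drop the
    sets it misses. *)
Definition small_cover A r c : Prop :=
  [/\ forall k, 0 < r k,
      forall k t t', A k t -> A k t' -> `|pt t - pt t'| <= r k,
      forall k, A k !=set0 -> r k `^ s <= c k,
      forall k, 0 <= c k &
      (\sum_(0 <= k <oo) (c k)%:E < (r0 `^ s)%:E)%E].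

Hypotheses (r0_gt0 : 0 < r0) (s_ge0 : 0 <= s) (theta_lt1 : theta < 1).
Hypothesis rho_itv : forall a, 0 < rho a <= theta.
Hypothesis pt_expand : forall a t t',
  rho a * `|pt t - pt t'| <= `|pt (scons a t) - pt (scons a t')|.
Hypothesis pt_gap : forall t t', t 0%N <> t' 0%N -> r0 <= `|pt t - pt t'|.
Hypothesis rho_sum : 1 <= \sum_a rho a `^ s.

Definition pull_cover (a : T) A : nat -> set (nat -> T) :=
  fun k => [set t | A k (scons a t)].
Definition pull_diam (a : T) r : nat -> R := fun k => r k / rho a.
(** Only sets meeting the copy with first letter [a] are charged; thus each weight is charged to at
    most one letter. *)
Definition pull_weight (a : T) A c : nat -> R :=
  fun k => if `[< pull_cover a A k !=set0 >] then c k / rho a `^ s else 0.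

Lemma rho_gt0 a : 0 < rho a.
Proof. by have /andP[] := rho_itv a. Qed.

Lemma small_cover_term A r c : small_cover A r c -> forall k, c k < r0 `^ s.
Proof.
case=> _ _ _ c0 cs k; rewrite -lte_fin; apply: le_lt_trans cs.
rewrite (@nneseriesD1 _ _ k xpredT)//; last by move=> *; rewrite lee_fin.
by rewrite leeDl// nneseries_ge0// => *; rewrite lee_fin.
Qed.

Lemma small_cover_diam A r c : small_cover A r c ->
  forall k, A k !=set0 -> r k < r0.
Proof.
move=> H k Ak; have := small_cover_term H k; case: H => r_gt0 _ rc _ _ ck.
rewrite ltNge; apply/negP => r0r.
have := le_lt_trans (rc k Ak) ck; rewrite ltNge; apply/negP; rewrite negbK.
by rewrite ge0_ler_powR// nnegrE ltW.
Qed.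

(** Averaging over the first letter: if every pulled total were at least [r0 ^ s], their combination
    with coefficients [rho a ^ s], whose sum is at least 1, would be too. But this combination is at
    most the original total, since a set shorter than [r0] cannot contain points with different
    first letters. *)
Lemma small_cover_pull A r c : small_cover A r c ->
  exists a, small_cover (pull_cover a A) (pull_diam a r) (pull_weight a A c).
Proof.
move=> H; have rr0 := small_cover_diam H.
case: (H) => r_gt0 Ar rc c0 cs.
have rhos a : 0 < rho a `^ s by rewrite powR_gt0// rho_gt0.
have w0 a k : 0 <= pull_weight a A c k.
  by rewrite /pull_weight; case: ifP => // _; rewrite divr_ge0// ltW.
suff [a Ha] : exists a, (\sum_(0 <= k <oo) (pull_weight a A c k)%:E
                          < (r0 `^ s)%:E)%E.
  exists a; split => //.
  - by move=> k; rewrite /pull_diam divr_gt0// rho_gt0.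
  - move=> k t t' At At'; rewrite /pull_diam ler_pdivlMr ?rho_gt0// mulrC.
    by apply: le_trans (pt_expand _ _ _) _; exact: Ar.
  - move=> k Ak; rewrite /pull_weight asboolT// /pull_diam.
    have -> : (r k / rho a) `^ s = r k `^ s / rho a `^ s.
      rewrite powRM ?invr_ge0 ?ltW ?rho_gt0//; congr *%R.
      by rewrite -{1}powR_inv1 ?ltW ?rho_gt0// -powRrM mulN1r powRN.
    rewrite ler_pM2r ?invr_gt0//; apply: rc.
    by case: Ak => t ?; exists (scons a t).
apply: contrapT => /forallNP Hn.
have : (\sum_(0 <= k <oo) (c k)%:E >= (r0 `^ s)%:E)%E.
  apply: (@le_trans _ _ (\sum_(a : T) (rho a `^ s)%:E *
     \sum_(0 <= k <oo) (pull_weight a A c k)%:E)%E).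
    apply: (@le_trans _ _ (\sum_(a : T) (rho a `^ s)%:E * (r0 `^ s)%:E)%E).
      rewrite -ge0_sume_distrl//; last by move=> a _; rewrite lee_fin ltW.
      rewrite sumEFin -EFinM lee_fin -[leLHS]mul1r ler_wpM2r// powR_ge0//.
    apply: lee_sum => a _; apply: lee_wpmul2l; first by rewrite lee_fin ltW.
    by rewrite leNgt; apply/negP/Hn.
  rewrite (eq_bigr (fun a => \sum_(0 <= k <oo)
      ((rho a `^ s)%:E * (pull_weight a A c k)%:E))%E); last first.
    by move=> a _; rewrite nneseriesZl// => k _; rewrite lee_fin.
  rewrite -nneseries_sum; last by move=> *; rewrite lee_fin mulr_ge0// ltW.
  apply: lee_nneseries => [k _ _|k _].
    by apply: sume_ge0 => a _; rewrite lee_fin mulr_ge0// ltW.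
  under eq_bigr do rewrite -EFinM.
  rewrite sumEFin lee_fin.
  have [[a Aa]|/forallNP Ak] := pselect (exists a, pull_cover a A k !=set0).
    rewrite (bigD1 a)//= big1 ?addr0.
      by rewrite /pull_weight asboolT// mulrC divfK// gt_eqF.
    move=> b ba; rewrite /pull_weight; case: ifPn => [/asboolP[t At]|_];
      last by rewrite mulr0.
    case: Aa => t' At'.
    have := Ar _ _ _ At At'; have := @pt_gap (scons b t) (scons a t').
    move=> /(_ (fun h => negP ba (introT eqP h))) h1 h2.
    have := le_trans h1 h2; rewrite leNgt rr0//.
    by exists (scons b t).
  by rewrite big1// => a _; rewrite /pull_weight asboolF ?mulr0//; exact: Ak.
by rewrite leNgt cs.
Qed.

(* The weights are spread over first letters proportionally to rho ^ s, so some
   letter inherits a cover that is still small; iterating yields a point whose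
   covering sets would have rescaled diameters growing like theta ^ - n. *)
Lemma small_cover_uncovered A r c : small_cover A r c ->
  exists t, forall k, ~ A k t.
Proof.
move=> H.
pose inv st := small_cover st.1.1 st.1.2 st.2.
have /choice[g Hg] (st : (nat -> set (nat -> T)) * (nat -> R) * (nat -> R)) :
    exists a, inv st -> inv (pull_cover a st.1.1, pull_diam a st.1.2,
                             pull_weight a st.1.1 st.2).
  have [/small_cover_pull[a Ha]|ninv] := pselect (inv st); first by exists a.
  (* Outside the invariant any letter will do; [T] is inhabited because an empty sum cannot reach
     1. *)
  case: (pickP T) => [a _|T0]; first by exists a.
  by have := rho_sum; rewrite big1 ?ler10// => a; have := T0 a.
pose step st := (pull_cover (g st) st.1.1, pull_diam (g st) st.1.2,
                             pull_weight (g st) st.1.1 st.2).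
pose st n := iter n step (A, r, c).
have inv_st n : inv (st n) by elim: n => [//|n IHn]; apply: Hg.
pose t n := g (st n).
exists t => k Akt.
have Ast n : (st n).1.1 k (fun j => t (n + j)%N).
  elim: n => [//|n IHn] /=; rewrite /pull_cover /=.
  suff -> : scons (g (st n)) (fun j => t (n.+1 + j)%N) = (fun j => t (n + j)%N)
    by [].
  by apply/funext => -[|j] /=; rewrite ?addn0// addSnnS.
have rst n : r k <= theta ^+ n * (st n).1.2 k.
  elim: n => [|n IHn]; first by rewrite expr0 mul1r.
  have [pos _ _ _ _] := inv_st n.
  apply: le_trans IHn _; rewrite exprSr -mulrA /= /pull_diam -/(st n).
  have th0 : 0 <= theta by have /andP[/ltW h1 h2] := rho_itv (t 0%N);
    apply: le_trans h2.
  rewrite ler_wpM2l ?exprn_ge0// mulrCA ler_peMr ?(ltW (pos k))//.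
  by rewrite ler_pdivlMr ?rho_gt0// mul1r; have /andP[] := rho_itv (g (st n)).
have th0 : 0 <= theta by have /andP[/ltW h1 h2] := rho_itv (t 0%N);
  apply: le_trans h2.
have : theta ^+ n * r0 @[n --> \oo] --> 0.
  rewrite -(mul0r r0); apply: cvgMl; apply: cvg_expr; by rewrite ger0_norm.
have rk0 : 0 < r k by case: H.
move/cvgrPdist_lt => /(_ _ rk0)[N _ /(_ N (leqnn _))] /=.
rewrite sub0r normrN ger0_norm ?mulr_ge0 ?exprn_ge0 ?(ltW r0_gt0)//.
apply/negP; rewrite -leNgt; apply: le_trans (rst N) _.
rewrite ler_wpM2l ?exprn_ge0// ltW// (small_cover_diam (inv_st N))//.
by exists (fun j => t (N + j)%N).
Qed.
End Moran.

(** * Hausdorff measures *)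

Section HausdorffBounds.
Set Implicit Arguments.
Unset Strict Implicit.
Context {R : realType}.
Implicit Types (s d e : R) (A U : set R).

Lemma diameter_ge U x y : U x -> U y -> ((`|x - y|)%:E <= diameter U)%E.
Proof. by move=> Ux Uy; apply: ereal_sup_ubound; exists (x, y). Qed.

Lemma diameter_le U d : (forall x y, U x -> U y -> `|x - y| <= d) ->
  (diameter U <= d%:E)%E.
Proof.
by move=> H; apply: ge_ereal_sup => _ [[x y] [/= Ux Uy] <-]; rewrite lee_fin H.
Qed.

Lemma diameter_pow0 s : diameter_pow s set0 = 0%E :> \bar R.
Proof. by rewrite /diameter_pow asboolT. Qed.

Lemma diameter_pow_ge0 s U : (0 <= diameter_pow s U)%E.
Proof. by rewrite /diameter_pow; case: ifP => // _; exact: poweR_ge0. Qed.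

Lemma diameter_pow_le s U d : 0 <= s -> 0 <= d ->
  (forall x y, U x -> U y -> `|x - y| <= d) ->
  (diameter_pow s U <= (d `^ s)%:E)%E.
Proof.
move=> s0 d0 H; rewrite /diameter_pow.
case: ifPn => [_|/asboolPn/eqP/set0P[x Ux]]; first by rewrite lee_fin powR_ge0.
have D0 := diameter_ge Ux Ux; rewrite subrr normr0 in D0.
rewrite -poweR_EFin; apply: gt0_ler_poweR => //.
- by rewrite in_itv /= D0 leey.
- by rewrite in_itv /= lee_fin d0 leey.
- exact: diameter_le.
Qed.

(** The descent divides and compares positive lengths, whereas a covering set may be a single point.
    A zero diameter is replaced by [e ^ (1 / s)], of weight [e], or by 1 if [s = 0], where a point
    already has weight 1. *)
Lemma diameter_pow_approx s e d U : 0 <= s -> 0 < e -> (diameter U <= d%:E)%E ->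
  exists r, [/\ 0 < r, forall x y, U x -> U y -> `|x - y| <= r &
    U !=set0 -> ((r `^ s)%:E <= diameter_pow s U + e%:E)%E].
Proof.
move=> s0 e0 dU; have [->|/set0P[x Ux]] := eqVneq U set0.
  by exists 1; split => // -[].
have D0 := diameter_ge Ux Ux; rewrite subrr normr0 in D0.
have [D DE] : exists D, diameter U = D%:E.
  exists (fine (diameter U)); rewrite fineK// fin_numE.
  by apply/andP; split; apply/eqP => h; rewrite h in dU D0.
have UD y z : U y -> U z -> `|y - z| <= D.
  by move=> Uy Uz; rewrite -lee_fin -DE; exact: diameter_ge.
rewrite /diameter_pow asboolF; last by move=> U0; rewrite U0 in Ux.
rewrite DE poweR_EFin -EFinD.
move: D0; rewrite DE lee_fin le_eqVlt => /predU1P[D0|D0]; last first.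
  by exists D; split => // _; rewrite lee_fin lerDl ltW.
move: s0; rewrite le_eqVlt => /predU1P[<-|s0].
  exists 1; split => //; last by rewrite !powRr0 lee_fin lerDl ltW.
  by move=> y z Uy Uz; apply: le_trans (UD _ _ Uy Uz) _; rewrite -D0.
exists (e `^ s^-1); split; first by rewrite powR_gt0.
  by move=> y z Uy Uz; apply: le_trans (UD _ _ Uy Uz) _; rewrite -D0 powR_ge0.
by move=> _; rewrite lee_fin -powRrM mulVf ?gt_eqF// powRr1 ?lerDr ?powR_ge0 ?ltW.
Qed.

(** A null set would have a cover of total weight below [r0 ^ s / 2]. Making all diameters positive
    costs at most the other half, spread over a geometric series, and the descent then finds a point
    of the range of [pt] outside the cover. *)
Lemma hausdorff_measure_neq0 (T : finType) (rho : T -> R)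
    (pt : (nat -> T) -> R) (r0 theta s : R) A :
  0 < r0 -> 0 <= s -> theta < 1 -> (forall a, 0 < rho a <= theta) ->
  (forall a t t',
    rho a * `|pt t - pt t'| <= `|pt (scons a t) - pt (scons a t')|) ->
  (forall t t', t 0%N <> t' 0%N -> r0 <= `|pt t - pt t'|) ->
  1 <= \sum_a rho a `^ s ->
  range pt `<=` A -> hausdorff_measure s A <> 0%E.
Proof.
move=> r0_gt0 s0 th1 rho_itv pt_exp pt_gap rho_sum ptA mu0.
pose e := r0 `^ s / 2; have e0 : 0 < e by rewrite divr_gt0// powR_gt0.
have : (hausdorff_premeasure s 1 A < e%:E)%E.
  apply: le_lt_trans (_ : 0 < _)%E; last by rewrite lte_fin.
  by rewrite -mu0; apply: ereal_sup_ubound; exists 1 => //=.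
move=> /ereal_inf_lt[_ [U [AU dU] <-] Ue].
have eps0 n : 0 < e / (2 ^ n.+1)%:R by rewrite divr_gt0// ltr0n expn_gt0.
have /choice[r Hr] n := @diameter_pow_approx s _ 1 (U n) s0 (eps0 n) (dU n).
have Ufin n : diameter_pow s (U n) \is a fin_num.
  rewrite ge0_fin_numE ?diameter_pow_ge0//; apply: le_lt_trans (ltry e).
  apply: le_trans (ltW Ue); rewrite (@nneseriesD1 _ _ n xpredT)// => [|k _].
    by rewrite leeDl// nneseries_ge0// => *; exact: diameter_pow_ge0.
  exact: diameter_pow_ge0.
pose c n := fine (diameter_pow s (U n)) + e / (2 ^ n.+1)%:R.
have cE n : (c n)%:E = (diameter_pow s (U n) + (e / (2 ^ n.+1)%:R)%:E)%E.
  by rewrite EFinD fineK.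
have Hc : small_cover pt r0 s (fun n => [set t | U n (pt t)]) r c.
  split => [k|k t t'|k [t Ut]|k|].
  - by case: (Hr k).
  - by case: (Hr k) => _ Ur _; exact: Ur.
  - by case: (Hr k) => _ _; rewrite -lee_fin cE; apply; exists (pt t).
  - rewrite /c addr_ge0 ?fine_ge0 ?diameter_pow_ge0//.
    by rewrite divr_ge0// ltW.
  - under eq_eseriesr do rewrite cE.
    apply: (@le_lt_trans _ _ (\sum_(0 <= k <oo) diameter_pow s (U k) + e%:E)%E).
      by apply: epsilon_trick => [n|]; [exact: diameter_pow_ge0|exact: ltW].
    rewrite [X in (_ < X%:E)%E](splitr (r0 `^ s)) EFinD lteD2rE//.
have [t Ht] := small_cover_uncovered r0_gt0 s0 th1 rho_itv pt_exp pt_gap rho_sum Hc.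
have [n _ Un] := AU (pt t) (ptA _ (imageT _ _)).
exact: Ht Un.
Qed.

Lemma esum_subset (T : choiceType) (D E : set T) (a : T -> \bar R) :
  D `<=` E -> (\esum_(i in D) a i <= \esum_(i in E) a i)%E.
Proof.
move=> DE; apply: ge_ereal_sup => _ [F [finF FD] <-].
by apply: ereal_sup_ubound; exists F => //; split => // x /FD/DE.
Qed.

(** A finite subset carries all of the sum but [e]; [N] is chosen above the lengths of its
    elements. *)
Lemma esum_tail (T : choiceType) (D : set T) (a : T -> \bar R)
    (len : T -> nat) (e : R) :
  (forall t, (0 <= a t)%E) -> (\esum_(t in D) a t < +oo)%E -> 0 < e ->
  exists N, (\esum_(t in D `&` [set t | (N <= len t)%N]) a t <= e%:E)%E.
Proof.
move=> a0 Dfin e0.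
have Dfn : \esum_(t in D) a t \is a fin_num by rewrite ge0_fin_numE ?esum_ge0.
have [_ [F [finF FD] <-] HF] := ub_ereal_sup_adherent e0 Dfn.
exists (\max_(t <- fset_set F) len t).+1.
have F0 : (\sum_(t \in F) a t)%E \is a fin_num.
  rewrite -esum_fset// ge0_fin_numE ?esum_ge0//.
  by apply: le_lt_trans Dfin; exact: esum_subset.
rewrite -(leeD2lE _ _ F0); apply: le_trans (_ : \esum_(t in D) a t <= _)%E;
  last first.
  rewrite -leeBlDr//; exact: ltW.
rewrite -(esum_fset finF)// [leRHS](esumID F)//; apply: leeD.
  by apply: esum_subset => x Fx; split => //; exact: FD.
apply: esum_subset => x [Dx /= lenx]; split => // Fx.
move: lenx; rewrite ltnNge => /negP; apply.
by rewrite (big_rem x) ?in_fset_set ?inE//= leq_max leqnn.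
Qed.

(** The cover is enumerated through [pickle]. Integers that code nothing receive the empty set,
    whose weight is 0 even for [s = 0]. *)
Lemma hausdorff_premeasure_le_esum (T : countType) s d A (U : T -> set R) :
  A `<=` \bigcup_t U t -> 0 <= d -> (forall t, (diameter (U t) <= d%:E)%E) ->
  (hausdorff_premeasure s d A <= \esum_(t in [set: T]) diameter_pow s (U t))%E.
Proof.
move=> AU d0 dU.
pose V n := if pickle_inv n is Some t then U t else set0 : set R.
have VU t : V (pickle t) = U t by rewrite /V pickleK_inv.
apply: (@le_trans _ _ (\sum_(0 <= n <oo) diameter_pow s (V n))%E).
  apply: ereal_inf_lbound; exists V => //; split.
    by move=> x /AU[t _ Ux]; exists (pickle t) => //; rewrite VU.
  move=> n; rewrite /V; case: pickle_inv => [t|]; first exact: dU.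
  by apply: diameter_le.
rewrite nneseries_esumT; last by move=> n; exact: diameter_pow_ge0.
rewrite (esumID (range (@pickle T))); last by move=> *; exact: diameter_pow_ge0.
rewrite setTI [X in (_ + X)%E]esum1 ?adde0; last first.
  move=> n [_ /= nT]; rewrite /V; case E: (pickle_inv n) => [t|].
    by case: nT; exists t => //; have := @pickle_invK T n; rewrite E.
  exact: diameter_pow0.
rewrite esum_image; last by move=> t t' _ _ /(pcan_inj (@pickleK_inv T)).
by apply: le_esum => t _; rewrite VU.
Qed.

Lemma hausdorff_measure_ge0 s A : (0 <= hausdorff_measure s A)%E.
Proof.
apply: (@le_trans _ _ (hausdorff_premeasure s 1 A)).
  apply: le_ereal_inf_tmp => _ [U' _ <-].
  by apply: nneseries_ge0 => *; exact: diameter_pow_ge0.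
by apply: ereal_sup_ubound; exists 1 => //=.
Qed.


(* The limsup set of a summable family is null; T indexes the countably many
   copies of that family. *)
Lemma hausdorff_measure_limsup_eq0 (T V : countType) s A (W : set V)
    (U : T -> V -> set R) (d : V -> R) (len : V -> nat) :
  0 <= s -> (forall v, 0 <= d v) ->
  (forall t v x y, U t v x -> U t v y -> `|x - y| <= d v) ->
  (\esum_(v in W) (d v `^ s)%:E < +oo)%E ->
  (forall e, 0 < e -> exists N, forall v, (N <= len v)%N -> d v <= e) ->
  (forall x, A x -> exists t, forall N, exists v, [/\ W v, (N <= len v)%N & U t
    v x]) ->
  hausdorff_measure s A = 0%E.
Proof.
move=> s0 d0 dU Wfin d_small Acov; apply/eqP; rewrite eq_le; apply/andP; split;
  last first.
  exact: hausdorff_measure_ge0.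
apply: ge_ereal_sup => _ [eta /= eta0 <-].
apply/lee_addgt0Pr => e e0; rewrite add0e.
have [N0 HN0] := d_small _ eta0.
have /choice[N HN] (t : T) : exists N, (\esum_(v in W `&` [set v | (N <= len v)%N])
    (d v `^ s)%:E <= (e / (2 ^ (pickle t).+1)%:R)%:E)%E.
  apply: esum_tail => // [v|]; first by rewrite lee_fin powR_ge0.
  by rewrite divr_gt0// ltr0n expn_gt0.
(* Beyond [N0] the sets are finer than [eta]; beyond [N t] the tail of copy [t] weighs at most its
   share of [e] in a geometric series. *)
pose Q t := W `&` [set v | (maxn N0 (N t) <= len v)%N].
pose U' (p : T * V) := if `[< Q p.1 p.2 >] then U p.1 p.2 else set0.
apply: le_trans (@hausdorff_premeasure_le_esum _ s eta A U' _ _ _) _.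
- move=> x /Acov[t /(_ (maxn N0 (N t)))[v [Wv lv Ux]]].
  by exists (t, v) => //; rewrite /U' asboolT.
- exact: ltW.
- move=> [t v]; rewrite /U' /=; case: ifPn => [/asboolP[Wv /= lv]|_].
    apply: diameter_le => x y Ux Uy; apply: le_trans (dU _ _ _ _ Ux Uy) _.
    by apply: HN0; apply: leq_trans lv; exact: leq_maxl.
  by apply: diameter_le.
rewrite -setXTT (_ : setT `*` setT = setT `*`` (fun=> setT)); last first.
  by apply/seteqP; split => -[].
rewrite -(@esum_esum _ _ _ _ _ (fun t v => diameter_pow s (U' (t, v)))); last first.
  by move=> *; exact: diameter_pow_ge0.
apply: (@le_trans _ _ (\esum_(t in [set: T]) (e / (2 ^ (pickle t).+1)%:R)%:E)).
  apply: le_esum => t _; apply: le_trans (HN t).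
  rewrite [leRHS]esum_mkcond; apply: le_esum => v _.
  rewrite /U' /=; case: ifPn => [/asboolP[Wv /= lv]|_].
    rewrite ifT; first by apply: diameter_pow_le => // x y; exact: dU.
    by apply/mem_set; split => //=; apply: leq_trans lv; exact: leq_maxr.
  by rewrite diameter_pow0; case: ifP => _ //; rewrite lee_fin powR_ge0.
rewrite -(@esum_image _ _ _ setT pickle (fun n => (e / (2 ^ n.+1)%:R)%:E));
  last first.
  by move=> t t' _ _ /(pcan_inj (@pickleK_inv T)).
apply: (@le_trans _ _ (\esum_(n in setT) (e / (2 ^ n.+1)%:R)%:E)).
  exact: esum_subset.
rewrite -nneseries_esumT; first exact/epsilon_trick0/ltW.
by move=> n; rewrite lee_fin divr_ge0// ltW.
Qed.

Lemma hausdorff_measure_subset s A B : A `<=` B ->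
  (hausdorff_measure s A <= hausdorff_measure s B)%E.
Proof.
move=> AB; apply: ge_ereal_sup => _ [d /= d0 <-].
apply: le_trans (_ : hausdorff_premeasure s d B <= _)%E; last first.
  by apply: ereal_sup_ubound; exists d.
apply: le_ereal_inf_tmp => _ [U [BU dU] <-].
by apply: ereal_inf_lbound; exists U => //; split => //; exact: subset_trans BU.
Qed.

Lemma hausdorff_dim_subset A B : A `<=` B ->
  (hausdorff_dim A <= hausdorff_dim B)%E.
Proof.
move=> AB; apply: le_ereal_inf => _ [s [s0 Bs] <-]; exists s => //; split => //.
by apply/eqP; rewrite eq_le hausdorff_measure_ge0 -Bs hausdorff_measure_subset.
Qed.

End HausdorffBounds.

(** * Sums over words *)

Section ExtendedSums.
Set Implicit Arguments.
Unset Strict Implicit.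
Context {R : realType}.
Local Open Scope ereal_scope.

Lemma esum_finType (T : finType) (P : pred T) (f : T -> \bar R) :
  (forall t, 0 <= f t) -> \esum_(t in [set` P]) f t = \sum_(t | P t) f t.
Proof.
move=> f0; rewrite esum_fset//.
rewrite -(@bigfs _ _ _ _ (index_enum T))//; first exact: index_enum_uniq.
by move=> t _; rewrite mem_index_enum.
Qed.

Lemma esumZl_le (T : choiceType) (D : set T) (c : R) (a : T -> \bar R) :
  (0 <= c)%R -> (forall t, 0 <= a t) ->
  \esum_(t in D) (c%:E * a t) <= c%:E * \esum_(t in D) a t.
Proof.
move=> c0 a0; apply: ge_ereal_sup => _ [F FD <-].
rewrite -ge0_mule_fsumr//; apply: lee_wpmul2l; rewrite ?lee_fin//.
by apply: ereal_sup_ubound; exists F.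
Qed.

Lemma esum_setU_le (T : choiceType) (D E : set T) (a : T -> \bar R) :
  (forall t, 0 <= a t) ->
  \esum_(t in D `|` E) a t <= \esum_(t in D) a t + \esum_(t in E) a t.
Proof.
move=> a0; rewrite (esumID D)//; apply: leeD.
  by apply: esum_subset => x [].
by apply: esum_subset => x [[]].
Qed.

(** Elements of [S] may decompose in several ways. Choosing one decomposition for each is injective,
    because [h] recovers the element, and so embeds the left sum in the right one. *)
Lemma esum_cover_le (T1 T2 T3 : choiceType) (D : set T1) (E : T1 -> set T2)
    (h : T1 -> T2 -> T3) (S : set T3) (a : T3 -> \bar R) :
  (forall t, 0 <= a t) ->
  (forall z, S z -> exists x y, [/\ D x, E x y & z = h x y]) ->
  \esum_(z in S) a z <= \esum_(x in D) \esum_(y in E x) a (h x y).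
Proof.
move=> a0 cov; have [->|/set0P[z0 Sz0]] := eqVneq S set0.
  by rewrite esum_set0; apply: esum_ge0 => x _; exact: esum_ge0.
have [x0 [y0 _]] := cov _ Sz0.
have /choice[sg Hsg] (z : T3) : exists p : T1 * T2,
    S z -> [/\ D p.1, E p.1 p.2 & z = h p.1 p.2].
  have [Sz|nSz] := pselect (S z); last by exists (x0, y0).
  by have [x [y ?]] := cov _ Sz; exists (x, y).
rewrite (@esum_esum _ _ _ D E (fun x y => a (h x y)))//.
have -> : \esum_(z in S) a z = \esum_(z in S) a (h (sg z).1 (sg z).2).
  by apply: eq_esum => z Sz; have [_ _ {1}->] := Hsg _ Sz.
rewrite -(@esum_image _ _ _ S sg (fun p => a (h p.1 p.2))).
  by apply: esum_subset => _ [z Sz <-]; have [? ? _] := Hsg _ Sz; split.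
move=> z z' /set_mem Sz /set_mem Sz' zz'.
by have [_ _ ->] := Hsg _ Sz; have [_ _ ->] := Hsg _ Sz'; rewrite zz'.
Qed.

Lemma esum_geometric_lty (T : choiceType) (D : set T) (len : T -> nat)
    (a : T -> \bar R) (B theta : R) :
  (0 <= B)%R -> (0 < theta < 1)%R -> (forall t, 0 <= a t) ->
  (forall n, \esum_(t in D `&` [set t | len t = n]) a t <= (B * theta ^+ n)%:E) ->
  \esum_(t in D) a t < +oo.
Proof.
move=> B0 /andP[th0 th1] a0 Ha.
apply: (@le_lt_trans _ _ (B * (1 - theta)^-1)%:E); last exact: ltry.
apply: (@le_trans _ _ (\esum_(n in [set: nat])
    \esum_(t in D `&` [set t | len t = n]) a t)).
  by apply: (@esum_cover_le _ _ _ _ _ (fun=> id)) => // t Dt; exists (len t), t.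
rewrite -nneseries_esumT; last by move=> n; exact: esum_ge0.
apply: (@le_trans _ _ (\sum_(0 <= n <oo) (B * theta ^+ n)%:E)).
  by apply: lee_nneseries => [n _ _|n _]; [exact: esum_ge0|exact: Ha].
apply: lime_le; first by apply: is_cvg_nneseries => n _ _;
  rewrite lee_fin mulr_ge0// exprn_ge0// ltW.
apply: nearW => n; rewrite sumEFin lee_fin.
have := @geometric_le_lim R n B theta B0 th0; rewrite (ger0_norm (ltW th0)).
by move=> /(_ th1).
Qed.

End ExtendedSums.

(** * Submultiplicative weights on words, summed over levels of the total step *)

Section WordSums.
Set Implicit Arguments.
Unset Strict Implicit.
Context {R : realType} {I : finType}.
Implicit Types (psi : I -> int) (u v w : seq I).

Definition step_sum psi u : int := \sum_(i <- u) psi i.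

Lemma step_sum_nil psi : step_sum psi [::] = 0.
Proof. exact: big_nil. Qed.

Lemma step_sum_cons psi i u : step_sum psi (i :: u) = psi i + step_sum psi u.
Proof. exact: big_cons. Qed.

Lemma step_sum_cat psi u v : step_sum psi (u ++ v) = step_sum psi u + step_sum
  psi v.
Proof. exact: big_cat. Qed.

Lemma step_sum_repeat psi n u :
  step_sum psi (flatten (nseq n u)) = step_sum psi u *+ n.
Proof.
elim: n => [|n IHn]; first by rewrite step_sum_nil.
by rewrite /= step_sum_cat IHn mulrS.
Qed.

Lemma step_sumN psi u : step_sum (fun i => - psi i) u = - step_sum psi u.
Proof. by rewrite /step_sum sumrN. Qed.

(** If [psi i = - (b + 1)], then [b] copies of [u] and [n] copies of [i] add up to
    [b * n - n * (b + 1) = - n]. *)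
Lemma exists_step_sum_opp psi u i (n : nat) :
  step_sum psi u = n%:Z -> psi i < 0 -> exists v, step_sum psi v = - n%:Z.
Proof.
move=> un psii; have [b psib] : exists b : nat, psi i = - b.+1%:Z.
  by exists (`|psi i|.-1)%N; lia.
exists (flatten (nseq b u) ++ flatten (nseq n [:: i])).
rewrite step_sum_cat !step_sum_repeat step_sum_cons step_sum_nil un psib addr0.
by rewrite -[_ *+ b]mulr_natr -[_ *+ n]mulr_natr !natz; nia.
Qed.

(** The cut is made before the first letter of nonzero step. For nonnegative steps, removing that
    letter strictly lowers the level, which drives the next induction. *)
Lemma step_sum_split psi u : step_sum psi u != 0 -> exists v i w,
  [/\ u = v ++ i :: w, step_sum psi v = 0 & psi i != 0].
Proof.
elim: u => [|i u IHu]; first by rewrite step_sum_nil.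
rewrite step_sum_cons; have [psii|psii _] := eqVneq (psi i) 0; last first.
  by exists [::], i, u; rewrite step_sum_nil.
rewrite psii add0r => /IHu[v [j [w [-> v0 psij]]]]; exists (i :: v), j, w.
by rewrite step_sum_cons psii v0.
Qed.

Context (g : seq I -> R).
Hypothesis g_ge0 : forall u, 0 <= g u.
Hypothesis g_cat : forall u v, g (u ++ v) <= g u * g v.
Hypothesis g_catr : forall v, exists2 c, 0 < c & forall u, c * g u <= g (u ++ v).

Definition level_sum psi (j : int) : \bar R :=
  \esum_(u in [set u | step_sum psi u = j]) (g u)%:E.

(** Strong induction on the level: a word of positive level is a word of level 0, a letter of
    positive step and a word of smaller level. By submultiplicativity its level sum is at most the
    level 0 sum times a finite sum over that letter of smaller level sums. *)
Lemma level_sum_nonneg psi : (forall i, 0 <= psi i) ->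
  (level_sum psi 0 < +oo)%E -> forall n : nat, (level_sum psi n%:Z < +oo)%E.
Proof.
move=> psi0 fin0 n; have [m] := ubnP n; elim: m n => // m IHm [//|n] nm.
pose tail i := [set w | 0 < psi i /\ step_sum psi w = n.+1%:Z - psi i].
pose B := [set u | exists i w, u = i :: w /\ tail i w].
have Bfin : (\esum_(u in B) (g u)%:E < +oo)%E.
  apply: le_lt_trans (@esum_cover_le _ _ _ _ [set: I] tail cons _ _ _ _) _.
  - by move=> u; rewrite lee_fin.
  - by move=> u [i [w [-> iw]]]; exists i, w.
  rewrite (_ : setT = [set` xpredT]); last by apply/seteqP; split.
  rewrite esum_finType; last by move=> i; apply: esum_ge0 => w _; rewrite lee_fin.
  apply: lte_sum_pinfty => i _.
  have [psii|psii] := ltrP 0 (psi i); last first.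
    rewrite (_ : tail i = set0) ?esum_set0 ?ltry//.
    by apply/seteqP; split => // w []; rewrite ltNge psii.
  apply: (@le_lt_trans _ _ (\esum_(w in tail i) ((g [:: i])%:E * (g w)%:E))%E).
    by apply: le_esum => w _; rewrite -EFinM lee_fin -cat1s.
  apply: le_lt_trans (esumZl_le _ _ _) _ => //.
  apply: lte_mul_pinfty; rewrite ?lee_fin//.
  have [neg|pos] := ltrP (n.+1%:Z - psi i) 0.
    rewrite (_ : tail i = set0) ?esum_set0 ?ltry//.
    apply/seteqP; split => // w [_ Sw].
    have : 0 <= step_sum psi w by apply: sumr_ge0.
    by rewrite Sw leNgt neg.
  apply: le_lt_trans (IHm `|(n.+1%:Z - psi i)|%N _); last by lia.
  by apply: esum_subset => w [/= _ ->]; lia.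
apply: le_lt_trans (@esum_cover_le _ _ _ _ [set v | step_sum psi v = 0]
  (fun=> B) cat _ _ _ _) _.
- by move=> u; rewrite lee_fin.
- move=> u Su; have /step_sum_split[v [i [w [uE v0 psii]]]] : step_sum psi u != 0.
    by rewrite Su.
  exists v, (i :: w); split => //; exists i, w; split => //; split.
    by rewrite lt0r psii psi0.
  by move: Su; rewrite /= uE step_sum_cat step_sum_cons v0; lia.
have [b bE] : exists b, \esum_(u in B) (g u)%:E = b%:E.
  exists (fine (\esum_(u in B) (g u)%:E)); rewrite fineK// ge0_fin_numE//.
  by apply: esum_ge0 => *; rewrite lee_fin.
have b0 : 0 <= b by rewrite -lee_fin -bE; apply: esum_ge0 => *; rewrite lee_fin.
apply: (@le_lt_trans _ _ (\esum_(v in [set v | step_sum psi v = 0%R]) (b%:E *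
  (g v)%:E))%E).
  apply: le_esum => v _; rewrite -bE muleC bE.
  apply: le_trans (_ : \esum_(w in B) ((g v)%:E * (g w)%:E) <= _)%E.
    by apply: le_esum => w _; rewrite -EFinM lee_fin.
  by rewrite -bE; apply: esumZl_le => // w; rewrite lee_fin.
apply: le_lt_trans (esumZl_le _ _ _) _ => //.
by apply: lte_mul_pinfty; rewrite ?lee_fin.
Qed.

(** Appending [v] injects level [j] into level 0 and loses only a constant factor of the weight. *)
Lemma level_sum_return psi j v : step_sum psi v = - j ->
  (level_sum psi 0 < +oo)%E -> (level_sum psi j < +oo)%E.
Proof.
move=> vj fin0; have [c c0 Hc] := g_catr v.
apply: (@le_lt_trans _ _ (\esum_(u in [set u | step_sum psi u = j])
    ((c^-1)%:E * (g (u ++ v))%:E))%E).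
  apply: le_esum => u _; rewrite -EFinM lee_fin mulrC ler_pdivlMr// mulrC.
  exact: Hc.
apply: le_lt_trans (esumZl_le _ _ _) _; rewrite ?invr_ge0 ?(ltW c0)//.
  by move=> w; rewrite lee_fin.
apply: lte_mul_pinfty; rewrite ?lee_fin ?invr_ge0 ?(ltW c0)//.
rewrite -(@esum_image _ _ _ _ (cat^~ v) (fun u => (g u)%:E)); last first.
  move=> u u' _ _ /= uv; have /eqP := congr1 size uv.
  rewrite !size_cat eqn_add2r => /eqP su; move/eqP: uv.
  by rewrite eqseq_cat// => /andP[/eqP].
apply: le_lt_trans fin0; apply: esum_subset => _ [u uj <-] /=.
by rewrite step_sum_cat vj uj subrr.
Qed.

(** Either some word leads back from level [n] to 0, or level [n] is empty, or no letter has a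
    negative step, since such a letter together with a word of level [n] would yield a way back. *)
Lemma level_sum_nat psi (n : nat) :
  (level_sum psi 0 < +oo)%E -> (level_sum psi n%:Z < +oo)%E.
Proof.
move=> fin0.
have [[v vn]|nov] := pselect (exists v, step_sum psi v = - n%:Z).
  exact: level_sum_return vn fin0.
have [[u un]|nou] := pselect (exists u, step_sum psi u = n%:Z); last first.
  rewrite /level_sum (_ : [set _ | _] = set0) ?esum_set0 ?ltry//.
  by apply/seteqP; split => // u un; apply: nou; exists u.
apply: level_sum_nonneg => // i; rewrite leNgt; apply/negP => psii.
by apply: nov; exact: exists_step_sum_opp un psii.
Qed.

Lemma level_sum_int psi (j : int) :
  (level_sum psi 0 < +oo)%E -> (level_sum psi j < +oo)%E.
Proof.
case: j => [n|n] fin0; first exact: level_sum_nat.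
(* A negative level is a positive level for the opposite steps. *)
have : (level_sum (fun i => - psi i)%R n.+1%:Z < +oo)%E.
  apply: level_sum_nat; apply: le_lt_trans fin0.
  by apply: esum_subset => u /=; rewrite step_sumN; lia.
apply: le_lt_trans; apply: esum_subset => u /=; rewrite step_sumN; lia.
Qed.

Lemma bounded_level_sum psi (K : R) : (level_sum psi 0 < +oo)%E ->
  (\esum_(u in [set u | `|(step_sum psi u)%:~R : R| <= K]%R) (g u)%:E < +oo)%E.
Proof.
move=> fin0.
have Hn (n : nat) : (\esum_(u in [set u | (`|step_sum psi u| < n)%N]) (g u)%:E
  < +oo)%E.
  elim: n => [|n IHn].
    by rewrite (_ : [set _ | _] = set0) ?esum_set0 ?ltry//; apply/seteqP; split.
  apply: (@le_lt_trans _ _ (\esum_(u in [set u | (`|step_sum psi u| < n)%N] `|`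
    ([set u | step_sum psi u = n%:Z] `|` [set u | step_sum psi u = (- n%:Z)%R]))
      (g u)%:E)%E).
    apply: esum_subset => u /=.
    move: (step_sum psi u) => z zn.
    have [?|[?|?]] : (`|z| < n)%N \/ (z = n%:Z \/ z = - n%:Z) by lia.
    - by left.
    - by right; left.
    - by right; right.
  apply: le_lt_trans (esum_setU_le _ _ _) _; first by move=> u; rewrite lee_fin.
  apply: lte_add_pinfty => //.
  apply: le_lt_trans (esum_setU_le _ _ _) _; first by move=> u; rewrite lee_fin.
  by apply: lte_add_pinfty; exact: level_sum_int.
have [n Kn] : exists n : nat, K < n%:R.
  by exists (Num.truncn `|K|).+1; apply: le_lt_trans (ler_norm _) (truncnS_gt _).
apply: le_lt_trans (Hn n); apply: esum_subset => u /= uK.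
have := le_lt_trans uK Kn; rewrite -intr_norm -[n%:R]/((n%:Z)%:~R) ltr_int.
by lia.
Qed.

End WordSums.

(** * Real analysis of a single branch on a closed interval *)

Section Branch.
Set Implicit Arguments.
Unset Strict Implicit.
Context {R : realType}.
Implicit Types (J : set R) (f : R -> R) (a b x y : R).

Lemma closure_bounded_interval J : is_interval J -> J° !=set0 ->
  J `<=` `[0, 1] -> exists a b, [/\ a < b, closure J = `[a, b]%classic & `]a,
    b[ `<=` J].
Proof.
move=> itvJ [x0 x0J] J01.
have Jx0 : J x0 by exact: interior_subset.
have hiJ : has_inf J.
  by split; [exists x0|exists 0 => y /J01 /=; rewrite in_itv /= => /andP[]].
have hsJ : has_sup J.
  by split; [exists x0|exists 1 => y /J01 /=; rewrite in_itv /= => /andP[]].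
have infJ y : J y -> inf J <= y by apply: ge_inf; case: hiJ.
have supJ y : J y -> y <= sup J by apply: ub_le_sup; case: hsJ.
have ooJ : `]inf J, sup J[ `<=` J.
  move=> x /=; rewrite in_itv /= => /andP[ax xb].
  have [y Jy yx] := inf_lt hiJ.1 ax; have [z Jz xz] := sup_gt hsJ.1 xb.
  by apply: (itvJ _ _ Jy Jz); rewrite !ltW.
have ab : inf J < sup J.
  have /nbhs_ballP[e /= e0 eJ] := x0J.
  have : J (x0 + e / 2).
    apply: eJ; rewrite /ball /= opprD addrA subrr sub0r normrN ger0_norm
      ?divr_ge0 ?ltW//.
    by rewrite ltr_pdivrMr// ltr_pMr// ltr1n.
  move=> /supJ; apply: lt_le_trans; apply: le_lt_trans (infJ _ Jx0) _.
  by rewrite ltrDl divr_gt0.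
exists (inf J), (sup J); split => //; apply/seteqP; split.
  rewrite closureE; apply: smallest_sub; first exact: interval_closed.
  by move=> x Jx /=; rewrite in_itv /= infJ ?supJ.
move=> x /=; rewrite in_itv /= => /andP[ax xb] B /nbhs_ballP[e /= e0 eB].
move: ab ooJ ax xb; move: (inf J) (sup J) => a b ab ooJ ax xb.
suff [t tab xt] : exists2 t, a < t < b & `|x - t| < e.
  by exists t; split; [apply: ooJ; rewrite /= in_itv|exact: eB].
have [xb'|bx] := ltrP x b.
  exists (x + Num.min (e / 2) ((b - x) / 2)).
    by case: (lerP (e / 2) ((b - x) / 2)) => ?; lra.
  by rewrite ltr_norml; case: (lerP (e / 2) ((b - x) / 2)) => ?; lra.
exists (x - Num.min (e / 2) ((x - a) / 2)).
  by case: (lerP (e / 2) ((x - a) / 2)) => ?; lra.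
by rewrite ltr_norml; case: (lerP (e / 2) ((x - a) / 2)) => ?; lra.
Qed.

(** A continuous injection on an interval is strictly monotone, so at an end point it takes an
    extreme value, which by surjectivity is 0 or 1. *)
Lemma bij_itv_endpoints a b f x : a < b -> set_bij `[a, b] `[0, 1] f ->
  {within `[a, b], continuous f} -> x \in `[a, b] -> 0 < f x < 1 -> x \in `]a, b[.
Proof.
move=> ab [fab finj fsurj] fcont xab fx01.
have [y0 y0ab fy0] : exists2 y, y \in `[a, b] & f y = 0.
  by have [|y ? ?] := fsurj 0; [rewrite /= in_itv /= lexx ler01|exists y].
have [y1 y1ab fy1] : exists2 y, y \in `[a, b] & f y = 1.
  by have [|y ? ?] := fsurj 1; [rewrite /= in_itv /= lexx ler01|exists y].
have aab : a \in `[a, b] by rewrite in_itv /= lexx ltW.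
have bab : b \in `[a, b] by rewrite in_itv /= lexx ltW.
have finj' : {in `[a, b] &, injective f}.
  by move=> s t sab tab; apply: finj; rewrite inE.
have mono := itv_continuous_inj_mono fcont finj'.
move: (xab) (y0ab) (y1ab); rewrite !in_itv /= => /andP[ax xb] /andP[ay0 y0b]
  /andP[ay1 y1b].
have [xa|xa] := eqVneq x a; last have [xb'|xb'] := eqVneq x b; last first.
- by rewrite lt_neqAle eq_sym xa ax lt_neqAle xb' xb.
- subst x; exfalso; case: mono => m.
    move: y1b; rewrite le_eqVlt => /predU1P[y1E|/(m _ _ y1ab bab)];
      rewrite ?fy1; last by lra.
    by move: fy1; rewrite y1E; lra.
  move: y0b; rewrite le_eqVlt => /predU1P[y0E|/(m _ _ bab y0ab)]; rewrite ?fy0;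
    last by lra.
  by move: fy0; rewrite y0E; lra.
- subst x; exfalso; case: mono => m.
    move: ay0; rewrite le_eqVlt => /predU1P[y0E|/(m _ _ aab y0ab)];
      rewrite ?fy0; last by lra.
    by move: fy0; rewrite -y0E; lra.
  move: ay1; rewrite le_eqVlt => /predU1P[y1E|/(m _ _ y1ab aab)]; rewrite ?fy1;
    last by lra.
  by move: fy1; rewrite -y1E; lra.
Qed.

Lemma is_derive_within a b f x : cvg (quotient_within `[a, b]%classic f x) ->
  x \in `]a, b[ -> is_derive x 1 f (derive_within `[a, b]%classic f x).
Proof.
move=> fcvg xab.
have H : (fun h => h^-1 *: ((f \o shift x) (h *: 1) - f x)) @ 0^' -->
    derive_within `[a, b]%classic f x.
  apply/cvgrPdist_lt => e e0.
  have /cvgrPdist_lt/(_ e e0) := fcvg.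
  rewrite near_withinE => /nbhs_ballP[d /= d0 Hd].
  move: xab; rewrite in_itv /= => /andP[ax xb].
  apply/nbhs_ballP; exists (Num.min d (Num.min (x - a) (b - x))) => /=.
    by rewrite !lt_min d0 !subr_gt0 ax xb.
  move=> h; rewrite /ball /= sub0r normrN !lt_min => /andP[hd /andP[ha hb]] h0.
  have := Hd (h + x); rewrite /ball /= opprD addrCA subrr addr0 normrN => /(_ hd).
  have -> : h + x - x = h by rewrite addrK.
  rewrite /GRing.scale /= !mulr1 [h^-1 * _]mulrC; apply.
    by rewrite -subr_eq0 addrK.
  rewrite /= in_itv /=; move: ha hb; rewrite !ltr_norml; lra.
apply: DeriveDef; first by apply/cvg_ex; eexists; exact: H.
exact/cvg_lim.
Qed.

Lemma holder_continuous a b eps C (g : R -> R) : 0 < eps -> a < b ->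
  (forall x y, x \in `[a, b] -> y \in `[a, b] ->
    `|g x - g y| <= C * `|x - y| `^ eps) ->
  {within `[a, b], continuous g}.
Proof.
move=> eps0 ab Hg; apply/subspace_continuousP => x xab.
apply/cvgrPdist_lt => e e0; rewrite near_withinE.
have C0 : 0 < `|C| + 1 by rewrite ltr_wpDl.
have eC : 0 < e / (`|C| + 1) by rewrite divr_gt0.
apply/nbhs_ballP; exists ((e / (`|C| + 1)) `^ eps^-1) => /=; first exact: powR_gt0.
move=> y; rewrite /ball /= => xy yab.
apply: le_lt_trans (Hg _ _ xab yab) _.
apply: (@le_lt_trans _ _ ((`|C| + 1) * `|x - y| `^ eps)).
  rewrite ler_wpM2r ?powR_ge0//; apply: le_trans (ler_norm _) _; by rewrite lerDl.
rewrite mulrC -ltr_pdivlMr//.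
have -> : e / (`|C| + 1) = ((e / (`|C| + 1)) `^ eps^-1) `^ eps.
  by rewrite -powRrM mulVf ?gt_eqF// powRr1// ltW.
by rewrite gt0_ltr_powR// nnegrE ?powR_ge0.
Qed.

Lemma ln_lipschitz x y : 1 <= x -> 1 <= y -> `|ln x - ln y| <= `|x - y|.
Proof.
wlog xy : x y / y <= x.
  move=> H x1 y1; have [yx|xy] := orP (le_total y x); first exact: H.
  by rewrite distrC [leRHS]distrC; exact: H.
move=> x1 y1; have x0 : 0 < x by lra.
have y0 : 0 < y by lra.
rewrite !ger0_norm ?subr_ge0 ?ler_ln ?posrE//.
rewrite -ln_div ?posrE//.
have -> : x / y = 1 + (x - y) / y by field; rewrite gt_eqF.
have q0 : 0 <= (x - y) / y by rewrite divr_ge0 ?subr_ge0// ltW.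
apply: le_trans (le_ln1Dx _) _; first by lra.
by rewrite ler_pdivrMr// ler_peMr ?subr_ge0.
Qed.

End Branch.

(** * Inverse branches *)

Section InverseBranches.
Set Implicit Arguments.
Unset Strict Implicit.
Context {R : realType} {m : nat} {eps : R} {J : 'I_m -> set R} {F : R -> R}
  {H : 'I_m -> R -> R} (hF : expanding_interval_map eps J F H).
Implicit Types (i j : 'I_m) (x y : R).

Local Notation h := (inverse_branch J H).
Local Notation D i := (closure (J i)).
Local Notation dH i := (derive_within (closure (J i)) (H i)).

Lemma branch_itv i :
  exists a b, [/\ a < b, D i = `[a, b]%classic & `]a, b[ `<=` J i].
Proof.
apply: closure_bounded_interval.
- exact: (domain_interval hF).
- exact: (domain_interior hF).
- exact: (domain_sub hF).
Qed.

Lemma branch_bij i : set_bij (D i) `[0, 1] (H i).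
Proof. by case: (branch_diffeo hF i). Qed.

Lemma branch_sub i x : D i x -> x \in `[0, 1].
Proof.
have : D i `<=` `[0, 1]%classic; last by exact.
rewrite closureE; apply: smallest_sub; first exact: interval_closed.
exact: (domain_sub hF).
Qed.

Lemma inverse_branch_dom i x : x \in `[0, 1] -> D i (h i x).
Proof.
by move=> x01; have [+ _ _] := @bijpinv_bij _ _ (fun=> 0) _ _ _ (branch_bij i);
  apply.
Qed.

Lemma inverse_branchK i x : x \in `[0, 1] -> H i (h i x) = x.
Proof.
move=> x01; have [_ _ fsurj] := branch_bij i.
by apply: (surjpK (fun=> 0) fsurj); rewrite inE.
Qed.

Lemma inverse_branch_itv i x : x \in `[0, 1] -> h i x \in `[0, 1].
Proof. by move=> /(@inverse_branch_dom i)/branch_sub. Qed.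

Lemma inverse_branch_inj i x y : x \in `[0, 1] -> y \in `[0, 1] ->
  h i x = h i y -> x = y.
Proof.
by move=> x01 y01 xy; rewrite -(inverse_branchK i x01) xy inverse_branchK.
Qed.

Lemma inverse_branch_oo i a b x : a < b -> D i = `[a, b]%classic ->
  x \in `]0, 1[ -> h i x \in `]a, b[.
Proof.
move=> ab Dab x01; have x01' := subset_itv_oo_cc x01.
apply: (bij_itv_endpoints ab (f := H i)).
- by rewrite -Dab; exact: branch_bij.
- by rewrite -Dab; exact: (branch_continuous hF).
- by have := @inverse_branch_dom i _ x01'; rewrite Dab.
- by rewrite inverse_branchK//; move: x01; rewrite in_itv.
Qed.

Lemma inverse_branch_inner i x : x \in `]0, 1[ ->
  J i (h i x) /\ h i x \in `]0, 1[.
Proof.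
move=> x01; have [a [b [ab Dab Jab]]] := branch_itv i.
have xab := inverse_branch_oo ab Dab x01; split; first exact: Jab.
have : D i a by rewrite Dab /= in_itv /= lexx ltW.
have : D i b by rewrite Dab /= in_itv /= lexx ltW.
move=> /branch_sub + /branch_sub; move: xab; rewrite !in_itv /=; lra.
Qed.

(** Closures of different branch domains may share an end point. The image of an inner point,
    however, has a neighbourhood inside [J i], and a point of the closure of [J j] makes that
    neighbourhood meet [J j]. *)
Lemma inverse_branch_disjoint i j x : x \in `]0, 1[ -> D j (h i x) -> i = j.
Proof.
move=> x01 Dj; have [a [b [ab Dab Jab]]] := branch_itv i.
have xab := inverse_branch_oo ab Dab x01.
have [t [Jjt /Jab Jit]] : J j `&` `]a, b[ !=set0.
  by apply: Dj; apply: open_nbhs_nbhs; split => //; exact: interval_open.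
by apply: (domain_disjoint hF) => //; exists t.
Qed.

(** The mean value theorem for [H i] between the two images. The location of [c] is recorded because
    the distortion estimate compares the derivative at [c] with that at a coded point. *)
Lemma inverse_branch_mean i x y : x \in `[0, 1] -> y \in `[0, 1] ->
  exists c, [/\ D i c, `|c - h i x| <= `|h i x - h i y| &
    `|x - y| = `|dH i c| * `|h i x - h i y|].
Proof.
move=> x01 y01; have [a [b [ab Dab Jab]]] := branch_itv i.
(* The additional bound on the distance to [h i y] makes the claim symmetric, as the reduction to
   [h i x < h i y] requires. *)
suff [c [? ? _ ?]] : exists c, [/\ D i c, `|c - h i x| <= `|h i x - h i y|,
    `|c - h i y| <= `|h i x - h i y| &
    `|x - y| = `|dH i c| * `|h i x - h i y|] by exists c.
have [xy|xy] := eqVneq (h i x) (h i y).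
  exists (h i x); rewrite -xy !subrr !normr0 mulr0 (inverse_branch_inj x01 y01 xy).
  by rewrite subrr normr0; split => //; exact: inverse_branch_dom.
wlog lt_xy : x y x01 y01 xy / h i x < h i y.
  move=> W; move: xy; rewrite neq_lt => /orP[xy|yx].
    by apply: W => //; rewrite lt_eqF.
  have [||c [? ? ? ?]] := W y x y01 x01 => //; first by rewrite lt_eqF.
  by exists c; rewrite [ `|h i x - _|]distrC [ `|x - _|]distrC.
have := @inverse_branch_dom i _ x01; have := @inverse_branch_dom i _ y01.
rewrite Dab /= !in_itv /= => /andP[ay yb] /andP[ax xb].
have [||c cxy Hc] := @MVT _ (H i) (dH i) _ _ lt_xy.
- move=> z; rewrite in_itv /= => /andP[xz zy].
  rewrite Dab; apply: is_derive_within.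
    have [_ [+ _] _] := branch_diffeo hF i; rewrite Dab; apply.
    by rewrite /= in_itv /=; lra.
  by rewrite in_itv /=; lra.
- have := @branch_continuous _ _ _ _ _ _ hF i; rewrite Dab;
    apply: continuous_subspaceW.
  by move=> z /=; rewrite !in_itv /=; lra.
exists c; move: cxy; rewrite in_itv /= => /andP[xc cy].
split; first by rewrite in_itv /=; lra.
- by rewrite [leRHS]distrC !ger0_norm; lra.
- by rewrite ![ `|_ - h i y|]distrC !ger0_norm; lra.
- rewrite distrC [ `|h i x - _|]distrC -normrM -Dab -Hc.
  by rewrite !inverse_branchK.
Qed.

Lemma branch_derive_holder i : exists2 C, 0 <= C &
  forall x y, D i x -> D i y -> `|dH i x - dH i y| <= C * `|x - y| `^ eps.
Proof.
have [_ [_ [C HC]] _] := branch_diffeo hF i.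
exists `|C| => // x y Dx Dy; apply: le_trans (HC _ _ Dx Dy) _.
by rewrite ler_wpM2r ?powR_ge0// ler_norm.
Qed.

(** The derivative is continuous on each compact branch domain, so its modulus attains a minimum
    above 1, and there are finitely many branches. The default 2 of the minimum also exceeds 1. *)
Lemma branch_expansion_rate : exists2 lambda, 1 < lambda &
  forall i x, D i x -> lambda <= `|dH i x|.
Proof.
have /choice[l Hl] i : exists l, 1 < l /\ forall x, D i x -> l <= `|dH i x|.
  have [a [b [ab Dab Jab]]] := branch_itv i.
  have [C C0 HC] := branch_derive_holder i.
  have eps0 : 0 < eps by case/andP: (holder_exponent hF).
  have [|c cab Hc] := @EVT_min R (fun x => `|dH i x|) a b (ltW ab).
    apply: (@holder_continuous _ a b eps C) => // x y xab yab.
    by apply: le_trans (ler_dist_dist _ _) _; apply: HC; rewrite Dab.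
  exists `|dH i c|; split; first by apply: (branch_expanding hF); rewrite Dab.
  by move=> x; rewrite {1}Dab; exact: Hc.
exists (\big[Num.min/2]_i l i).
  by apply: lt_bigmin; rewrite ?ltr1n// => i _; case: (Hl i).
by move=> i x Dx; apply: bigmin_inf => //; case: (Hl i) => _; apply.
Qed.

Lemma branch_log_derive_holder : exists2 C, 0 <= C & forall i x y,
  D i x -> D i y -> `|ln `|dH i x| - ln `|dH i y| | <= C * `|x - y| `^ eps.
Proof.
have /choice[C HC] i : exists C, 0 <= C /\ forall x y, D i x -> D i y ->
    `|dH i x - dH i y| <= C * `|x - y| `^ eps.
  by have [C C0 HC] := branch_derive_holder i; exists C.
exists (\sum_i C i); first by apply: sumr_ge0 => i _; case: (HC i).
move=> i x y Dx Dy; apply: le_trans (ln_lipschitz _ _) _.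
- by rewrite ltW// (branch_expanding hF).
- by rewrite ltW// (branch_expanding hF).
apply: le_trans (ler_dist_dist _ _) _.
apply: le_trans ((HC i).2 _ _ Dx Dy) _; rewrite ler_wpM2r ?powR_ge0//.
by rewrite (bigD1 i)//= lerDl sumr_ge0// => j _; case: (HC j).
Qed.

End InverseBranches.

(** * Word maps, coding and distortion *)

Section WordMaps.
Set Implicit Arguments.
Unset Strict Implicit.
Context {R : realType} {m : nat} {eps : R} {J : 'I_m -> set R} {F : R -> R}
  {H : 'I_m -> R -> R} (hF : expanding_interval_map eps J F H).
Implicit Types (i j : 'I_m) (x y : R) (u v : seq 'I_m) (w : nat -> 'I_m).

Local Notation h := (inverse_branch J H).
Local Notation hw := (word_map J H).
Local Notation D i := (closure (J i)).
Local Notation dH i := (derive_within (closure (J i)) (H i)).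
Local Notation shift := (@Defs.shift m).
Local Notation phi := (geometric_potential J H).

Lemma word_map_cat u v x : hw (u ++ v) x = hw u (hw v x).
Proof. by rewrite /word_map foldr_cat. Qed.

Lemma word_map_itv u x : x \in `[0, 1] -> hw u x \in `[0, 1].
Proof. by move=> x01; elim: u => //= i u; exact: (inverse_branch_itv hF). Qed.

Lemma word_map_inner u x : x \in `]0, 1[ -> hw u x \in `]0, 1[.
Proof.
by move=> x01; elim: u => //= i u IHu; have [] := inverse_branch_inner hF i IHu.
Qed.

Lemma word_map_inj u x y : x \in `[0, 1] -> y \in `[0, 1] ->
  hw u x = hw u y -> x = y.
Proof.
move=> x01 y01; elim: u => //= i u IHu.
by move=> /(inverse_branch_inj hF (word_map_itv _ x01) (word_map_itv _ y01))/IHu.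
Qed.

Lemma word_map_disjoint u v x y : size u = size v -> x \in `]0, 1[ ->
  y \in `[0, 1] -> hw u x = hw v y -> u = v.
Proof.
move=> uv x01 y01; elim: u v uv => [|i u IHu] [|j v] //= [uv] xy.
have ij : i = j.
  apply: (inverse_branch_disjoint hF (word_map_inner u x01)); rewrite xy.
  exact/(inverse_branch_dom hF)/word_map_itv.
subst j; congr cons; apply: IHu => //.
apply: (inverse_branch_inj hF _ _ xy); last exact: word_map_itv.
exact/word_map_itv/subset_itv_oo_cc.
Qed.

Lemma mkseq_shiftS w n : mkseq w n.+1 = w 0%N :: mkseq (shift w) n.
Proof. by rewrite /mkseq /= -add1n iotaDl -map_comp. Qed.

Lemma mkseq_shiftD w n k : mkseq w (n + k) = mkseq w n ++ mkseq (iter n shift w) k.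
Proof.
elim: n w => // n IHn w; rewrite addSn !mkseq_shiftS IHn cat_cons -iterSr.
by rewrite [iter n.+1 _ w]iterSr.
Qed.

Context {lambda : R} (lambda_gt1 : 1 < lambda)
  (expand : forall i x, D i x -> lambda <= `|dH i x|).
Local Notation theta := (lambda^-1).

Lemma theta_itv : 0 < theta < 1.
Proof.
have l1 := lambda_gt1; have l0 : 0 < lambda by lra.
by rewrite invr_gt0 l0 invf_lt1.
Qed.

Lemma inverse_branch_contract i x y : x \in `[0, 1] -> y \in `[0, 1] ->
  `|h i x - h i y| <= theta * `|x - y|.
Proof.
move=> x01 y01; have [c [Dc _ ->]] := inverse_branch_mean hF i x01 y01.
have := lambda_gt1 => l1; rewrite mulrC ler_pdivlMr; last by lra.
by rewrite mulrC ler_wpM2r// expand.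
Qed.

Lemma word_map_contract u x y : x \in `[0, 1] -> y \in `[0, 1] ->
  `|hw u x - hw u y| <= theta ^+ size u * `|x - y|.
Proof.
move=> x01 y01; elim: u => [|i u IHu] /=; first by rewrite expr0 mul1r.
apply: le_trans (inverse_branch_contract _ _ _) _; rewrite ?word_map_itv//.
by rewrite exprS -mulrA ler_wpM2l//; have /andP[/ltW] := theta_itv.
Qed.

Lemma dist_itv01 x y : x \in `[0, 1] -> y \in `[0, 1] -> `|x - y| <= 1.
Proof. by rewrite !in_itv /= => ? ?; rewrite ler_norml; lra. Qed.

Lemma word_map_diam u x y : x \in `[0, 1] -> y \in `[0, 1] ->
  `|hw u x - hw u y| <= theta ^+ size u.
Proof.
move=> x01 y01; apply: le_trans (word_map_contract _ _ _) _ => //.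
by rewrite ler_piMr ?dist_itv01// exprn_ge0//; have /andP[/ltW] := theta_itv.
Qed.

Lemma theta_small (e : R) : 0 < e -> exists N, forall n, (N <= n)%N ->
  theta ^+ n < e.
Proof.
move=> e0; have /andP[t0 t1] := theta_itv.
have : theta ^+ n @[n --> \oo] --> 0 by apply: cvg_expr; rewrite ger0_norm// ltW.
move=> /cvgrPdist_lt/(_ _ e0)[N _ HN]; exists N => n Nn.
by have := HN n Nn; rewrite /= sub0r normrN ger0_norm// exprn_ge0// ltW.
Qed.

Let approx w n := hw (mkseq w n) 0.

Lemma itv01_0 : (0 : R) \in `[0, 1].
Proof. by rewrite in_itv /= lexx ler01. Qed.

Lemma itv01_1 : (1 : R) \in `[0, 1].
Proof. by rewrite in_itv /= lexx ler01. Qed.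

Let approx_itv w n : approx w n \in `[0, 1].
Proof. exact/word_map_itv/itv01_0. Qed.

Let approx_cvg w : cvg (approx w @ \oo).
Proof.
apply/cauchy_cvgP/cauchy_exP => e e0; have [N HN] := theta_small e0.
exists (approx w N), N => // n /= Nn.
rewrite /ball /= -(subnKC Nn) /approx mkseq_shiftD word_map_cat.
apply: le_lt_trans (HN N (leqnn _)).
have := @word_map_diam (mkseq w N) 0 (hw (mkseq (iter N shift w) (n - N)) 0)
  itv01_0.
by rewrite size_mkseq; apply; exact/word_map_itv/itv01_0.
Qed.

Let approx_lim_itv w : lim (approx w @ \oo) \in `[0, 1].
Proof.
rewrite in_itv /=; apply/andP; split.
  by apply: limr_ge => //; apply: nearW => n; have := approx_itv w n;
    rewrite in_itv => /andP[].
by apply: limr_le => //; apply: nearW => n; have := approx_itv w n;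
  rewrite in_itv => /andP[].
Qed.

Let approx_lim_shift w :
  lim (approx w @ \oo) = h (w 0%N) (lim (approx (shift w) @ \oo)).
Proof.
apply/cvg_lim => //; rewrite -(cvg_shiftS (approx w)).
apply/cvgrPdist_lt => e e0.
have /cvgrPdist_lt/(_ _ e0) := @approx_cvg (shift w).
apply: filterS => n; apply: le_lt_trans.
have -> : [sequence approx w n.+1]_n n = h (w 0%N) (approx (shift w) n).
  by rewrite /= /approx mkseq_shiftS.
apply: le_trans (inverse_branch_contract _ _ _) _.
- exact: approx_lim_itv.
- exact: approx_itv.
by rewrite ler_piMl//; have /andP[_ /ltW] := theta_itv.
Qed.

(** [coding] picks a point with [get], so the nested intersection must be shown inhabited. The
    images of 0 under the prefixes of [w] form a Cauchy sequence, and its limit commutes with the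
    inverse branches. *)
Lemma coding_word w n :
  exists2 y, y \in `[0, 1] & coding J H w = hw (mkseq w n) y.
Proof.
suff : (\bigcap_k (hw (mkseq w k) @` `[0, 1])) (coding J H w).
  by move=> /(_ n I)[y y01 <-]; exists y.
apply: (@getPex _ (\bigcap_k (hw (mkseq w k) @` `[0, 1]))).
exists (lim (approx w @ \oo)) => k _.
exists (lim (approx (iter k shift w) @ \oo)); first exact: approx_lim_itv.
elim: k w => [|k IHk] w //.
by rewrite mkseq_shiftS /= -iterS iterSr IHk -approx_lim_shift.
Qed.

Lemma coding_itv w : coding J H w \in `[0, 1].
Proof. by have [y y01 ->] := coding_word w 0. Qed.

Lemma coding_unique w x :
  (forall n, exists2 y, y \in `[0, 1] & x = hw (mkseq w n) y) -> x = coding J H w.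
Proof.
move=> Hx; apply/eqP; rewrite -subr_eq0 -normr_le0 leNgt; apply/negP => e0.
have [N /(_ N (leqnn _))] := theta_small e0.
apply/negP; rewrite -leNgt.
have [y y01 ->] := Hx N; have [z z01 ->] := coding_word w N.
by have := word_map_diam (mkseq w N) y01 z01; rewrite size_mkseq.
Qed.

Lemma coding_shift w : coding J H w = h (w 0%N) (coding J H (shift w)).
Proof.
apply/esym/coding_unique => -[|n].
  by exists (h (w 0%N) (coding J H (shift w))) => //;
    exact/(inverse_branch_itv hF)/coding_itv.
by have [y y01 ->] := coding_word (shift w) n; exists y; rewrite // mkseq_shiftS.
Qed.

Definition prepend u w : nat -> 'I_m := foldr (@scons 'I_m) w u.

Lemma shift_scons i w : shift (scons i w) = w.
Proof. by []. Qed.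

Lemma prepend_cat u v w : prepend (u ++ v) w = prepend u (prepend v w).
Proof. exact: foldr_cat. Qed.

Lemma mkseq_prepend u w : mkseq (prepend u w) (size u) = u.
Proof. by elim: u => // i u IHu; rewrite mkseq_shiftS /= IHu. Qed.

Lemma iter_shift_prepend u w : iter (size u) shift (prepend u w) = w.
Proof. by elim: u => // i u IHu; rewrite /= -iterS iterSr. Qed.

Lemma prepend_mkseq w n : prepend (mkseq w n) (iter n shift w) = w.
Proof.
elim: n w => // n IHn w; rewrite mkseq_shiftS /= -iterS iterSr IHn.
by apply/funext => -[].
Qed.

Lemma coding_prepend u w : coding J H (prepend u w) = hw u (coding J H w).
Proof. by elim: u => // i u IHu; rewrite coding_shift /= shift_scons IHu. Qed.

Lemma birkhoff_sumS (f : (nat -> 'I_m) -> R) n w :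
  birkhoff_sum f n.+1 w = f w + birkhoff_sum f n (shift w).
Proof.
rewrite /birkhoff_sum big_nat_recl//=; congr +%R.
by apply: eq_bigr => k _; rewrite -iterS iterSr.
Qed.

Lemma birkhoff_sum_cat (f : (nat -> 'I_m) -> R) n k w :
  birkhoff_sum f (n + k) w = birkhoff_sum f n w + birkhoff_sum f k (iter n shift w).
Proof.
elim: n w => [|n IHn] w.
  by rewrite {2}/birkhoff_sum big_nil add0r.
by rewrite addSn !birkhoff_sumS IHn addrA iterSr.
Qed.

Context {C : R} (C_ge0 : 0 <= C) (log_holder : forall i x y, D i x -> D i y ->
  `|ln `|dH i x| - ln `|dH i y| | <= C * `|x - y| `^ eps).

(** The sum over all [k] of the Hoelder errors [C * (2 * theta ^ k) ^ eps]. *)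
Definition distortion : R :=
  C * 2 `^ eps * (1 - theta `^ eps)^-1.

Let eps_gt0 : 0 < eps.
Proof. by case/andP: (holder_exponent hF). Qed.

Let q_itv : 0 < theta `^ eps < 1.
Proof.
have /andP[t0 t1] := theta_itv; rewrite powR_gt0//=.
apply: (@lt_le_trans _ _ (1 `^ eps)); last by rewrite powR1.
by rewrite gt0_ltr_powR// nnegrE ltW.
Qed.

Lemma distortion_ge0 : 0 <= distortion.
Proof.
have /andP[_ /ltW q1] := q_itv.
by rewrite /distortion !mulr_ge0 ?powR_ge0// invr_ge0 subr_ge0.
Qed.

(* The mean value point at each level lies within 2 * theta ^+ n of the coded
   point, so the Hoelder errors of log |H'| add up to a geometric series. *)
Lemma word_map_birkhoff u w x y : x \in `[0, 1] -> y \in `[0, 1] ->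
  expR (birkhoff_sum phi (size u) (prepend u w) - distortion) * `|x - y|
    <= `|hw u x - hw u y| <=
  expR (birkhoff_sum phi (size u) (prepend u w) + distortion) * `|x - y|.
Proof.
move=> x01 y01.
(* Each letter adds an error, so the induction on the word runs with the partial sums instead of
   their limit. *)
pose E n := series (geometric (C * 2 `^ eps) (theta `^ eps)) n.
have EE n : E n <= distortion.
  have /andP[q0 q1] := q_itv.
  apply: geometric_le_lim => //; first by rewrite mulr_ge0// powR_ge0.
  by rewrite ger0_norm ?ltW.
suff /andP[lo hi] : expR (birkhoff_sum phi (size u) (prepend u w) - E (size u))
  * `|x - y|
    <= `|hw u x - hw u y| <=
  expR (birkhoff_sum phi (size u) (prepend u w) + E (size u)) * `|x - y|.
  apply/andP; split; first by apply: le_trans lo;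
    rewrite ler_wpM2r// ler_expR lerD2l lerN2.
  by apply: (le_trans hi); rewrite ler_wpM2r// ler_expR lerD2l.
elim: u => [|i u /andP[lo hi]].
  by rewrite /birkhoff_sum big_nil /E /series /= big_nil subr0 addr0 expR0
    mul1r lexx.
rewrite birkhoff_sumS shift_scons.
set S := birkhoff_sum _ _ _ in lo hi *.
have ux := word_map_itv u x01; have uy := word_map_itv u y01.
have [c [Dc cx xy]] := inverse_branch_mean hF i ux uy.
have dc0 : 0 < `|dH i c| by apply: lt_le_trans (expand Dc);
  apply: lt_trans lambda_gt1.
have hxy : `|h i (hw u x) - h i (hw u y)| = expR (- ln `|dH i c|) * `|hw u x -
  hw u y|.
  by rewrite expRN lnK ?posrE// xy mulKf// gt_eqF.
pose z := coding J H (prepend (i :: u) w).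
have zE : z = h i (hw u (coding J H w)) by rewrite /z coding_prepend.
have zu : hw u (coding J H w) \in `[0, 1] by exact/word_map_itv/coding_itv.
have Dz : D i z by rewrite zE; exact: (inverse_branch_dom hF).
have phiz : phi (prepend (i :: u) w) = - ln `|dH i z| by [].
have cz : `|c - z| <= 2 * theta ^+ size u.
  apply: le_trans (ler_distD (h i (hw u x)) _ _) _.
  have th1 : theta <= 1 by have /andP[_ /ltW] := theta_itv.
  have t2 (a b : R) : a \in `[0, 1] -> b \in `[0, 1] ->
      `|h i (hw u a) - h i (hw u b)| <= theta ^+ size u.
    move=> a01 b01; apply: le_trans (inverse_branch_contract _ _ _) _;
      rewrite ?word_map_itv//.
    by apply: le_trans (ler_piMl _ th1) (word_map_diam _ _ _).
  rewrite mulr_natl mulr2n; apply: lerD; first by apply: le_trans cx _; exact: t2.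
  by rewrite zE; apply: t2 => //; exact: coding_itv.
have err : `|ln `|dH i c| - ln `|dH i z| | <= C * 2 `^ eps * (theta `^ eps) ^+
  size u.
  apply: le_trans (log_holder Dc Dz) _; rewrite -mulrA ler_wpM2l//.
  have th0 : 0 <= theta by have /andP[/ltW] := theta_itv.
  rewrite -powR_mulrn ?powR_ge0// powRAC powR_mulrn// -powRM ?exprn_ge0//.
  by rewrite ge0_ler_powR// ?nnegrE ?(ltW eps_gt0)// mulr_ge0// exprn_ge0.
have ES : E (size (i :: u)) = E (size u) + C * 2 `^ eps * (theta `^ eps) ^+ size u.
  by rewrite /E /series /= big_nat_recr.
move: err; rewrite ler_norml => /andP[err1 err2].
rewrite [hw (i :: u) x]/= [hw (i :: u) y]/= hxy phiz ES; apply/andP; split.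
  rewrite (_ : _ - _ = (- ln `|dH i z| - C * 2 `^ eps * (theta `^ eps) ^+ size u)
     + (S - E (size u))); last by ring.
  rewrite expRD -mulrA; apply: ler_pM => //;
    rewrite ?expR_ge0 ?mulr_ge0 ?expR_ge0//.
  by rewrite ler_expR; lra.
rewrite (_ : _ + _ + _ = (- ln `|dH i z| + C * 2 `^ eps * (theta `^ eps) ^+ size u)
     + (S + E (size u))); last by ring.
rewrite expRD -mulrA; apply: ler_pM => //; rewrite ?expR_ge0//.
by rewrite ler_expR; lra.
Qed.

End WordMaps.

(** * Bounded distortion, almost additivity of word sums and separation of images *)

Section Distortion.
Set Implicit Arguments.
Unset Strict Implicit.
Context {R : realType} {m : nat} {eps : R} {J : 'I_m -> set R} {F : R -> R}
  {H : 'I_m -> R -> R} (hF : expanding_interval_map eps J F H).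
Context {lambda : R} (lambda_gt1 : 1 < lambda) (expand : forall i x,
  closure (J i) x -> lambda <= `|derive_within (closure (J i)) (H i) x|).
Context {C : R} (C_ge0 : 0 <= C) (log_holder : forall i x y,
  closure (J i) x -> closure (J i) y ->
  `|ln `|derive_within (closure (J i)) (H i) x|
    - ln `|derive_within (closure (J i)) (H i) y| | <= C * `|x - y| `^ eps).
Implicit Types (i j : 'I_m) (x y : R) (u v : seq 'I_m) (w : nat -> 'I_m).

Local Notation hw := (word_map J H).
Local Notation shift := (@Defs.shift m).
Local Notation phi := (geometric_potential J H).
Local Notation theta := (lambda^-1).
Local Notation E := (@distortion R eps lambda C).
Local Notation S u w := (birkhoff_sum phi (size u) (prepend u w)).
Local Notation ws u := (word_sum phi u).

Let word_birkhoff u w x y : x \in `[0, 1] -> y \in `[0, 1] ->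
  expR (S u w - E) * `|x - y| <= `|hw u x - hw u y| <= expR (S u w + E) * `|x - y|.
Proof. exact: (word_map_birkhoff hF lambda_gt1 expand C_ge0 log_holder). Qed.

(** Both Birkhoff sums estimate the same length, the distance between the images of 0 and 1, each up
    to a factor [exp E]. *)
Lemma birkhoff_compare u w w' : S u w <= S u w' + 2 * E.
Proof.
have /andP[lo _] := word_birkhoff u w (itv01_0) (itv01_1).
have /andP[_ hi] := word_birkhoff u w' (itv01_0) (itv01_1).
have := le_trans lo hi; rewrite sub0r normrN normr1 !mulr1 ler_expR; lra.
Qed.

Lemma cylinder_prepend u w : cylinder u w -> w = prepend u (iter (size u) shift w).
Proof. by move=> uw; rewrite -{1}(prepend_mkseq w (size u)) uw. Qed.

Lemma prepend_cylinder u w : cylinder u (prepend u w).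
Proof. exact: mkseq_prepend. Qed.

Let word_sum_ub u w :
  ubound [set birkhoff_sum phi (size u) w' | w' in cylinder u] (S u w + 2 * E).
Proof. by move=> _ [w' /cylinder_prepend -> <-]; exact: birkhoff_compare. Qed.

Lemma birkhoff_le_word_sum u w : S u w <= ws u.
Proof.
apply: ub_le_sup; first by exists (S u w + 2 * E); exact: word_sum_ub.
by exists (prepend u w) => //; exact: prepend_cylinder.
Qed.

Lemma word_sum_le u w : ws u <= S u w + 2 * E.
Proof.
apply: ge_sup; last exact: word_sum_ub.
by exists (S u w); exists (prepend u w) => //; exact: prepend_cylinder.
Qed.

Context (w0 : nat -> 'I_m).

Lemma word_map_upper u x y : x \in `[0, 1] -> y \in `[0, 1] ->
  `|hw u x - hw u y| <= expR (ws u + E) * `|x - y|.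
Proof.
move=> x01 y01; have /andP[_ hi] := word_birkhoff u w0 x01 y01.
apply: le_trans hi _; rewrite ler_wpM2r// ler_expR lerD2r.
exact: birkhoff_le_word_sum.
Qed.

Lemma word_map_lower u x y : x \in `[0, 1] -> y \in `[0, 1] ->
  expR (ws u - 3 * E) * `|x - y| <= `|hw u x - hw u y|.
Proof.
move=> x01 y01; have /andP[lo _] := word_birkhoff u w0 x01 y01.
apply: le_trans lo; rewrite ler_wpM2r// ler_expR.
by have := word_sum_le u w0; lra.
Qed.

Lemma word_sum_cat_le u v : ws (u ++ v) <= ws u + ws v.
Proof.
apply: ge_sup.
  by exists (S (u ++ v) w0); exists (prepend (u ++ v) w0) => //;
    exact: prepend_cylinder.
move=> _ [w /cylinder_prepend -> <-]; rewrite size_cat birkhoff_sum_cat prepend_cat.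
rewrite iter_shift_prepend; apply: lerD; exact: birkhoff_le_word_sum.
Qed.

Lemma word_sum_cat_ge u v : ws u + ws v - 4 * E <= ws (u ++ v).
Proof.
have := birkhoff_le_word_sum (u ++ v) w0.
rewrite size_cat birkhoff_sum_cat prepend_cat iter_shift_prepend.
have := word_sum_le u (prepend v w0); have := word_sum_le v w0; lra.
Qed.

Lemma word_sum_decay u : ws u <= - ln lambda * (size u)%:R.
Proof.
apply: ge_sup.
  by exists (S u w0); exists (prepend u w0) => //; exact: prepend_cylinder.
move=> _ [w _ <-]; elim: (size u) w => [|n IHn] w.
  by rewrite /birkhoff_sum big_nil mulr0.
rewrite birkhoff_sumS -natr1 mulrDr mulr1 addrC; apply: lerD => //.
rewrite /geometric_potential lerN2 ler_ln ?posrE.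
- apply: expand; rewrite (coding_shift hF lambda_gt1 expand).
  exact/(inverse_branch_dom hF)/(coding_itv hF lambda_gt1 expand).
- by apply: lt_trans lambda_gt1.
- apply: lt_le_trans (expand _); first by apply: lt_trans lambda_gt1.
  rewrite (coding_shift hF lambda_gt1 expand).
  exact/(inverse_branch_dom hF)/(coding_itv hF lambda_gt1 expand).
Qed.

Lemma word_sum_le0 u : ws u <= 0.
Proof.
apply: le_trans (word_sum_decay u) _; rewrite mulNr oppr_le0 mulr_ge0// ln_ge0//.
exact: ltW.
Qed.

Lemma word_map_continuous u : {within `[0, 1], continuous (hw u)}.
Proof.
apply: (@holder_continuous _ 0 1 1 1) => // x y x01 y01.
rewrite mul1r powRr1//; apply: le_trans (word_map_contract hF lambda_gt1 expand
  _ x01 y01) _.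
have /andP[t0 t1] := theta_itv lambda_gt1.
by rewrite ler_piMl// exprn_ile1// ltW.
Qed.

Lemma word_map_IVT u a b z : a \in `[0, 1] -> b \in `[0, 1] ->
  hw u a <= z <= hw u b -> exists2 c, c \in `[0, 1] & hw u c = z.
Proof.
move=> a01 b01 zab.
have sub (p q : R) : p \in `[0, 1] -> q \in `[0, 1] -> `[p, q] `<=` `[0, 1]%classic.
  by rewrite !in_itv /= => ? ? x /=; rewrite !in_itv /=; lra.
have [ab|/ltW ba] := leP a b.
  have [||c cab <-] := @IVT _ (hw u) a b z ab.
  - by apply: (continuous_subspaceW _ (@word_map_continuous u)); exact: sub.
  - by rewrite ge_min le_max; move: zab => /andP[-> ->]; rewrite orbT.
  by exists c => //; exact: (sub _ _ a01 b01).
have [||c cab <-] := @IVT _ (hw u) b a z ba.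
- by apply: (continuous_subspaceW _ (@word_map_continuous u)); exact: sub.
- by rewrite ge_min le_max; move: zab => /andP[-> ->]; rewrite orbT.
by exists c => //; exact: (sub _ _ b01 a01).
Qed.

Let half_oo : (2^-1 : R) \in `]0, 1[.
Proof. by rewrite in_itv /=; lra. Qed.

Let half_cc : (2^-1 : R) \in `[0, 1].
Proof. exact: subset_itv_oo_cc half_oo. Qed.

(** Both images reach from [e] to their image of the midpoint. By the intermediate value theorem the
    midpoint image nearer to [e] lies in the other image, while images of inner points under
    different words of equal length avoid each other. *)
Lemma word_map_endpoint_unique (e : R) u v a b : e = 0 \/ e = 1 ->
  size u = size v -> a \in `[0, 1] -> b \in `[0, 1] ->
  hw u a = e -> hw v b = e -> u = v.
Proof.
move=> e01 uv a01 b01 ua vb.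
have disj := word_map_disjoint hF.
have [] := word_map_itv hF u half_cc; have [] := word_map_itv hF v half_cc.
rewrite !in_itv /= => /andP[v0 v1] /andP[u0 u1].
have [le|le] := orP (le_total (hw u 2^-1) (hw v 2^-1)); case: e01 => ee.
- have [|c c01 cE] := @word_map_IVT v b 2^-1 (hw u 2^-1) b01 half_cc.
    by rewrite vb ee u0.
  by apply: (disj _ _ _ _ uv half_oo c01); rewrite cE.
- have [|c c01 cE] := @word_map_IVT u 2^-1 a (hw v 2^-1) half_cc a01.
    by rewrite ua ee le v1.
  by apply/esym/(disj _ _ _ _ (esym uv) half_oo c01); rewrite cE.
- have [|c c01 cE] := @word_map_IVT u a 2^-1 (hw v 2^-1) a01 half_cc.
    by rewrite ua ee v0.
  by apply/esym/(disj _ _ _ _ (esym uv) half_oo c01); rewrite cE.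
- have [|c c01 cE] := @word_map_IVT v 2^-1 b (hw u 2^-1) half_cc b01.
    by rewrite vb ee le u1.
  by apply: (disj _ _ _ _ uv half_oo c01); rewrite cE.
Qed.

(** As [y] is inner, [hw v y] lies outside the interval between [hw u 0] and [hw u 1]. The point
    [hw u x] lies inside it, and the lower distortion bound keeps it away from both ends because [x]
    is [al] away from 0 and 1. *)
Lemma word_map_gap u v (al : R) x y : size u = size v -> u <> v ->
  0 < al -> al <= x <= 1 - al -> y \in `]0, 1[ ->
  expR (ws u - 3 * E) * al <= `|hw u x - hw v y|.
Proof.
move=> uv neq al0 xal y01.
have x01 : x \in `[0, 1] by rewrite in_itv /=; lra.
have far p : p \in `[0, 1] -> al <= `|p - x| ->
    expR (ws u - 3 * E) * al <= `|hw u p - hw u x|.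
  move=> p01 px; apply: le_trans (word_map_lower u p01 x01).
  by rewrite ler_wpM2l// ltW// expR_gt0.
have out c : c \in `[0, 1] -> hw u c <> hw v y.
  by move=> c01 /esym/(word_map_disjoint hF (esym uv) y01 c01)/esym.
have f0 : expR (ws u - 3 * E) * al <= `|hw u 0 - hw u x|.
  by apply: far; rewrite ?itv01_0// sub0r normrN; apply: le_trans (ler_norm _); lra.
have f1 : expR (ws u - 3 * E) * al <= `|hw u 1 - hw u x|.
  by apply: far; rewrite ?itv01_1//; apply: le_trans (ler_norm _); lra.
have x0 : 0 < x by lra.
have x1 : x < 1 by lra.
have finj : {in `[0, 1] &, injective (hw u)}.
  by move=> p q p01 q01; exact: (word_map_inj hF).
have out01 : ~ hw u 0 <= hw v y <= hw u 1.
  by move=> /(@word_map_IVT u 0 1 _ itv01_0 itv01_1)[c /out].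
have out10 : ~ hw u 1 <= hw v y <= hw u 0.
  by move=> /(@word_map_IVT u 1 0 _ itv01_1 itv01_0)[c /out].
case: (itv_continuous_inj_mono (@word_map_continuous u) finj) => mono.
  have m0 := mono _ _ itv01_0 x01 x0; have m1 := mono _ _ x01 itv01_1 x1.
  rewrite distrC ger0_norm ?subr_ge0 ?(ltW m0)// in f0.
  rewrite ger0_norm ?subr_ge0 ?(ltW m1)// in f1.
  have [lt0|ge0] := ltP (hw v y) (hw u 0); first by rewrite ger0_norm; lra.
  have [lt1|ge1] := ltP (hw u 1) (hw v y); first by rewrite distrC ger0_norm; lra.
  by case: out01; rewrite ge0 ge1.
have m0 := mono _ _ x01 itv01_0 x0; have m1 := mono _ _ itv01_1 x01 x1.
rewrite ger0_norm ?subr_ge0 ?(ltW m0)// in f0.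
rewrite distrC ger0_norm ?subr_ge0 ?(ltW m1)// in f1.
have [lt0|ge0] := ltP (hw v y) (hw u 1); first by rewrite ger0_norm; lra.
have [lt1|ge1] := ltP (hw u 0) (hw v y); first by rewrite distrC ger0_norm; lra.
by case: out10; rewrite ge0 ge1.
Qed.

Lemma word_map_away_from_endpoints v :
  (forall y, y \in `[0, 1] -> hw v y \in `]0, 1[) ->
  exists2 al, 0 < al & forall y, y \in `[0, 1] -> al <= hw v y <= 1 - al.
Proof.
move=> vin.
have [c c01 cmin] := EVT_min ler01 (@word_map_continuous v).
have [d d01 dmax] := EVT_max ler01 (@word_map_continuous v).
have := vin _ c01; have := vin _ d01;
  rewrite !in_itv /= => /andP[d0 d1] /andP[c0 c1].
exists (Num.min (hw v c) (1 - hw v d)); first by rewrite lt_min c0 subr_gt0.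
move=> y y01; have := cmin _ y01; have := dmax _ y01.
by case: (leP (hw v c) (1 - hw v d)) => ? ? ?; lra.
Qed.

End Distortion.

(** * Dynamics of the lift *)

Section LiftDynamics.
Set Implicit Arguments.
Unset Strict Implicit.
Context {R : realType} {m : nat} {eps : R} {J : 'I_m -> set R} {F : R -> R}
  {H : 'I_m -> R -> R} (hF : expanding_interval_map eps J F H).
Context {Psi : R -> int}
  (hPsi : forall i x y, J i x -> J i y -> Psi x = Psi y).
Context {lambda : R} (lambda_gt1 : 1 < lambda) (expand : forall i x,
  closure (J i) x -> lambda <= `|derive_within (closure (J i)) (H i) x|).
Implicit Types (i j : 'I_m) (x y : R) (u v : seq 'I_m) (w : nat -> 'I_m).

Local Notation hw := (word_map J H).
Local Notation shift := (@Defs.shift m).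
Local Notation code := (coding J H).
Local Notation exc := (exceptional_points J H).

Definition letter_step i : int := Psi (get (J i)).

(** The step depends on the first letter only, so the supremum runs over a single value; [w0] shows
    that the cylinder is inhabited. *)
Lemma word_sum_step u (w0 : nat -> 'I_m) :
  word_sum (@centered_step R m J Psi 0) u = (step_sum letter_step u)%:~R.
Proof.
have base n w : birkhoff_sum (@centered_step R m J Psi 0) n w
    = (step_sum letter_step (mkseq w n))%:~R.
  elim: n w => [|n IHn] w; first by rewrite /birkhoff_sum big_nil step_sum_nil.
  by rewrite birkhoff_sumS IHn mkseq_shiftS step_sum_cons intrD /centered_step
    subr0.
have S u' w : cylinder u' w -> birkhoff_sum (@centered_step R m J Psi 0) (size u') w
    = (step_sum letter_step u')%:~R.
  by rewrite /cylinder /= => uw; rewrite base uw.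
rewrite /word_sum -[RHS]sup1; congr sup; apply/seteqP; split => [_ [w uw <-]|_ ->].
  exact: S.
by exists (prepend u w0); [exact: mkseq_prepend|apply: S; exact: mkseq_prepend].
Qed.

Let code_itv w : code w \in `[0, 1] := coding_itv hF lambda_gt1 expand w.
Let code_shift w : code w = inverse_branch J H (w 0%N) (code (shift w)) :=
  coding_shift hF lambda_gt1 expand w.

Lemma coding_mkseq w n : code w = hw (mkseq w n) (code (iter n shift w)).
Proof.
by rewrite -{1}(prepend_mkseq w n) (coding_prepend hF lambda_gt1 expand).
Qed.

Lemma nonexceptional_inner w : ~ exc (code w) -> code w \in `]0, 1[.
Proof.
move=> nexc; have := code_itv w; rewrite !in_itv /= => /andP[c0 c1].
have word0 (e : R) : e = 0 \/ e = 1 -> code w <> e.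
  by move=> e01 ce; apply: nexc; exists [::] => //; exists e;
    [exact: e01|rewrite ce].
rewrite !lt_neqAle c0 c1 !andbT; apply/andP; split; apply/eqP => ce.
  by apply: (word0 0); [left|].
by apply: (word0 1); [right|].
Qed.

Lemma nonexceptional_shift w : ~ exc (code w) -> ~ exc (code (shift w)).
Proof.
move=> nexc [u _ [e e01 ue]]; apply: nexc; exists (w 0%N :: u) => //;
  exists e => //.
by rewrite /= ue -code_shift.
Qed.

(** If the coded point were the image of an end point under [u], a later inner point would pull back
    to an inner point with the same image under the prefix of [w] of length [size u]. Disjointness
    makes the two words equal, and injectivity makes the inner point an end point. *)
Lemma nonexceptional_of_inner w :
  (forall n, exists2 k, (n <= k)%N & code (iter k shift w) \in `]0, 1[) ->
    ~ exc (code w).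
Proof.
move=> inner [u _ [e e01 ue]]; have [k uk ck] := inner (size u).
have e01' : e \in `[0, 1] by case: e01 => ->; [exact: itv01_0|exact: itv01_1].
have : hw (mkseq w (size u)) (hw (mkseq (iter (size u) shift w) (k - size u))
    (code (iter k shift w))) = hw u e.
  by rewrite ue (coding_mkseq w k) -word_map_cat -mkseq_shiftD subnKC.
set z := hw (mkseq (iter _ _ _) _) _ => zE.
have z01 : z \in `]0, 1[ by exact: (word_map_inner hF).
have := word_map_disjoint hF (size_mkseq _ _) z01 e01' zE => uE.
rewrite uE in zE; have := word_map_inj hF (subset_itv_oo_cc z01) e01' zE => ze.
by move: z01; rewrite ze; case: e01 => ->; rewrite in_itv /= ltxx ?andbF.
Qed.

(** Since the coded point lies strictly between 0 and 1, only the summand of index [k] survives. *)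
Lemma psi_lift_coding w (k : int) : ~ exc (code w) ->
  psi_lift F Psi (code w + k%:~R) = code (shift w) + (k + letter_step (w 0%N))%:~R.
Proof.
move=> nexc; have cw := nonexceptional_inner nexc.
have csw := nonexceptional_inner (nonexceptional_shift nexc).
rewrite /psi_lift (fsbigE [:: k])//=; last first.
  move=> n _ /= nk; apply/eqP; apply: contraNT nk; rewrite mulf_eq0 negb_or.
  move=> /andP[_]; rewrite indicE pnatr_eq0 eqb0 negbK => /set_mem /=.
  rewrite -addrA -intrB; move: cw; rewrite !in_itv /= => /andP[c0 c1] /andP[d0 d1].
  have : (`|k - n| < 1 :> int)%R.
    rewrite -(ltr_int R) intr_norm ltr_norml; lra.
  by rewrite inE; lia.
rewrite big_cons big_nil mem_set// addr0 addrK indicE mem_set ?mulr1;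
  last exact: code_itv.
(* The shifted point is inner as well, which puts the coded point in [J (w 0)] itself and not merely
   in its closure, where [F] and [Psi] are not controlled. *)
have [Jc _] := inverse_branch_inner hF (w 0%N) csw.
rewrite -code_shift in Jc.
have -> : Psi (code w) = letter_step (w 0%N).
  apply: (hPsi Jc); apply: (@getPex _ (J (w 0%N))).
  by exists (code w).
rewrite -(branch_eq hF Jc) {1}(code_shift w) (inverse_branchK hF);
  last exact: code_itv.
by rewrite intrD; ring.
Qed.

Lemma iter_psi_lift_coding w (k : int) n : ~ exc (code w) ->
  iter n (psi_lift F Psi) (code w + k%:~R) =
  code (iter n shift w) + (k + step_sum letter_step (mkseq w n))%:~R.
Proof.
elim: n w k => [|n IHn] w k nexc; first by rewrite step_sum_nil addr0.
rewrite iterSr psi_lift_coding// IHn; last exact: nonexceptional_shift.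
rewrite -iterSr mkseq_shiftS. by rewrite step_sum_cons addrA.
Qed.

Lemma infinite_nat_ge (A : set nat) N : infinite_set A ->
  exists2 n, (N <= n)%N & A n.
Proof.
move=> Ainf; apply: contrapT => noA; apply: Ainf.
apply: (@sub_finite_set _ _ `I_N); last exact: finite_II.
move=> n An /=; rewrite ltnNge; apply/negP => Nn; apply: noA; by exists n.
Qed.

Lemma infinite_level (p : nat -> int) (M : nat) (A : set nat) : infinite_set A ->
  (forall n, A n -> (`|p n| <= M)%N) ->
    exists j : int, infinite_set [set n | p n = j].
Proof.
move=> Ainf Ap; apply: contrapT => noj; apply: Ainf.
apply: (@sub_finite_set _ _ (\bigcup_(k in `I_(2 * M).+1) [set n | p n = k%:Z -
  M%:Z])).
  move=> n /Ap pn; exists `|(p n + M%:Z)%R|%N => /=; lia.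
apply: bigcup_finite; first exact: finite_II.
by move=> k _; apply: contrapT => kinf; apply: noj; exists (k%:Z - M%:Z).
Qed.

(* Pigeonhole on the bounded displacements: from some time on, the itinerary
   of a recurrent point returns to a fixed level infinitely often. *)
Lemma recurrent_returns x : recurrent_set J H F Psi x ->
  exists (k : int) u, forall N,
  exists v, [/\ step_sum letter_step v = 0, (N <= size v)%N &
    exists2 y, y \in `[0, 1] & x = k%:~R + hw u (hw v y)].
Proof.
case=> -[[a k] /= [[[w _ <-] nexc] _] <-] [K Kinf].
pose p n : int := k + step_sum letter_step (mkseq w n).
have [j jinf] : exists j : int, infinite_set [set n | p n = j].
  apply: (@infinite_level p (Num.truncn (`|K| + 1)).+1 _ Kinf) => n /=.
  rewrite iter_psi_lift_coding// -/(p n) => cK.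
  have := code_itv (iter n shift w); rewrite in_itv /= => /andP[c0 c1].
  have : `|(p n)%:~R| <= `|K| + 1 :> R.
    by have := ler_norm K; move: cK; rewrite !ler_norml; lra.
  move=> /le_lt_trans/(_ (truncnS_gt _)).
  rewrite -intr_norm -[_.+1%:R]/((_.+1%:Z)%:~R) ltr_int.
  by move: (p n) (Num.truncn _) => z M; lia.
have [n0 _ pn0] := infinite_nat_ge 0 jinf.
exists k, (mkseq w n0) => N.
(* The displacements at times [n0] and [n1] agree, so the segment of the itinerary between them has
   total step 0. *)
have [n1 n1N pn1] := infinite_nat_ge (n0 + N) jinf.
have n01 : (n0 <= n1)%N by lia.
exists (mkseq (iter n0 shift w) (n1 - n0)); split.
- move: pn0 pn1; rewrite /= /p -[in mkseq w n1](subnKC n01) mkseq_shiftD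
    step_sum_cat; lia.
- by rewrite size_mkseq; lia.
- exists (code (iter n1 shift w)); first exact: code_itv.
  by rewrite addrC -word_map_cat -mkseq_shiftD subnKC// -coding_mkseq.
Qed.

Lemma uniformly_recurrent_sub :
  uniformly_recurrent_set J H F Psi `<=` recurrent_set J H F Psi.
Proof.
move=> x [xdom [K HK]]; split => //; exists K.
rewrite (_ : [set _ | _] = setT); first exact: infinite_nat.
by apply/seteqP; split => // n _; exact: HK.
Qed.

Lemma uniformly_recurrent_coding w (M : nat) :
  (forall n, exists2 k, (n <= k)%N & code (iter k shift w) \in `]0, 1[) ->
  (forall n, (`|step_sum letter_step (mkseq w n)| <= M)%N) ->
  uniformly_recurrent_set J H F Psi (code w).
Proof.
move=> /nonexceptional_of_inner nexc HM; split.
  by exists (code w, 0) => /=; rewrite ?addr0//; split => //; split => //; exists w.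
exists (M%:R + 1) => n.
have := iter_psi_lift_coding 0 n nexc; rewrite addr0 add0r => ->.
apply: le_trans (ler_normD _ _) _; rewrite addrC; apply: lerD.
  by rewrite -intr_norm -[M%:R]/((M%:Z)%:~R) ler_int; have := HM n; lia.
have := code_itv (iter n shift w); rewrite in_itv /= => /andP[c0 c1].
by rewrite ger0_norm.
Qed.

End LiftDynamics.

(** * The Poincare exponent *)

Section Concatenation.
Set Implicit Arguments.
Unset Strict Implicit.
Context {m : nat} {T : Type} (word : T -> seq 'I_m) (L : nat) (i0 : 'I_m).
Hypotheses (L_gt0 : (0 < L)%N) (size_word : forall a, size (word a) = L).
Local Notation shift := (@Defs.shift m).
Implicit Types (t : nat -> T) (w : nat -> 'I_m).

(** All blocks have length [L], so a letter is located by division; as [k %% L < L], the default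
    [i0] is never read. *)
Definition concat t : nat -> 'I_m :=
  fun k => nth i0 (word (t (k %/ L)%N)) (k %% L)%N.

Lemma iter_shiftE n w (k : nat) : iter n shift w k = w (n + k)%N.
Proof. by elim: n w k => // n IHn w k; rewrite iterSr IHn. Qed.

Lemma prependE u w k :
  prepend u w k = if (k < size u)%N then nth i0 u k else w (k - size u)%N.
Proof. by elim: u k => [|i u IHu] [|k] //=; rewrite ?subn0 ?IHu. Qed.

Lemma concat_scons a t : concat (scons a t) = prepend (word a) (concat t).
Proof.
apply/funext => k; rewrite prependE size_word /concat.
case: ltnP => kL; first by rewrite divn_small// modn_small.
by rewrite -{1 2}(subnKC kL) divnDl// divnn L_gt0 modnDl.
Qed.

Lemma concat_behead t :
  concat t = prepend (word (t 0%N)) (concat (fun k => t k.+1)).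
Proof. by rewrite -concat_scons; congr concat; apply/funext => -[]. Qed.

Lemma iter_shift_concat t n :
  iter (n * L) shift (concat t) = concat (fun k => t (n + k)%N).
Proof.
by apply/funext => k; rewrite iter_shiftE /concat divnMDl// modnMDl.
Qed.

(** Complete blocks contribute nothing, so only the last block, of at most [L] letters, counts. *)
Lemma step_sum_concat_bounded (psi : 'I_m -> int) :
  (forall a, step_sum psi (word a) = 0) ->
  exists M, forall t n, (`|step_sum psi (mkseq (concat t) n)| <= M)%N.
Proof.
move=> word0; pose B := (\sum_i `|psi i|)%N.
have bound u : (`|step_sum psi u| <= size u * B)%N.
  elim: u => [|i u IHu]; first by rewrite step_sum_nil.
  rewrite step_sum_cons /= mulSn.
  have : (`|psi i| <= B)%N by rewrite /B (bigD1 i)//= leq_addr.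
  by move: IHu; move: (step_sum psi u) (psi i) (size u * B)%N => *; lia.
exists (L * B)%N => t n; have [k] := ubnP n; elim: k n t => // k IHk n t nk.
have [nL|Ln] := leqP n L.
  by apply: leq_trans (bound _) _; rewrite size_mkseq leq_mul2r nL orbT.
rewrite -(subnKC (ltnW Ln)) mkseq_shiftD step_sum_cat.
set w' := concat (fun k => t k.+1).
have e1 : mkseq (concat t) L = word (t 0%N).
  by have := mkseq_prepend (word (t 0%N)) w'; rewrite size_word -concat_behead.
have e2 : iter L shift (concat t) = w'.
  by have := iter_shift_prepend (word (t 0%N)) w'; rewrite size_word -concat_behead.
rewrite e1 e2 word0 add0r; apply: IHk; move: L_gt0 => ?; lia.
Qed.

End Concatenation.

(** * Null recurrent set where the series converges, positive measure below the exponent *)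

Section PoincareExponent.
Set Implicit Arguments.
Unset Strict Implicit.
Context {R : realType} {m : nat} {eps : R} {J : 'I_m -> set R} {F : R -> R}
  {H : 'I_m -> R -> R} (hF : expanding_interval_map eps J F H).
Context {Psi : R -> int}
  (hPsi : forall i x y, J i x -> J i y -> Psi x = Psi y).
Context {lambda : R} (lambda_gt1 : 1 < lambda) (expand : forall i x,
  closure (J i) x -> lambda <= `|derive_within (closure (J i)) (H i) x|).
Context {C : R} (C_ge0 : 0 <= C) (log_holder : forall i x y,
  closure (J i) x -> closure (J i) y ->
  `|ln `|derive_within (closure (J i)) (H i) x|
    - ln `|derive_within (closure (J i)) (H i) y| | <= C * `|x - y| `^ eps).
Context (w0 : nat -> 'I_m).
Implicit Types (i j : 'I_m) (x y : R) (u v : seq 'I_m) (w : nat -> 'I_m).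

Local Notation hw := (word_map J H).
Local Notation shift := (@Defs.shift m).
Local Notation code := (coding J H).
Local Notation theta := (lambda^-1).
Local Notation E := (@distortion R eps lambda C).
Local Notation ws u := (word_sum (geometric_potential J H) u).
Local Notation psi := (@letter_step R m J Psi).

Let word_lower u x y : x \in `[0, 1] -> y \in `[0, 1] ->
  expR (ws u - 3 * E) * `|x - y| <= `|hw u x - hw u y| :=
  @word_map_lower _ _ _ _ _ _ hF _ lambda_gt1 expand _ C_ge0 log_holder w0 u x y.
Let word_upper u x y : x \in `[0, 1] -> y \in `[0, 1] ->
  `|hw u x - hw u y| <= expR (ws u + E) * `|x - y| :=
  @word_map_upper _ _ _ _ _ _ hF _ lambda_gt1 expand _ C_ge0 log_holder w0 u x y.
Let ws_decay u : ws u <= - ln lambda * (size u)%:R :=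
  word_sum_decay hF lambda_gt1 expand w0 u.
Let ws_le0 u : ws u <= 0 := word_sum_le0 hF lambda_gt1 expand w0 u.
Let ws_cat_le u v : ws (u ++ v) <= ws u + ws v :=
  word_sum_cat_le hF lambda_gt1 expand C_ge0 log_holder w0 u v.
Let ws_cat_ge u v : ws u + ws v - 4 * E <= ws (u ++ v) :=
  word_sum_cat_ge hF lambda_gt1 expand C_ge0 log_holder w0 u v.
Let E_ge0 : 0 <= E := distortion_ge0 hF lambda_gt1 C_ge0.
Let code_itv w : code w \in `[0, 1] := coding_itv hF lambda_gt1 expand w.

Lemma recurrent_null s K : 0 <= s -> 0 <= K ->
  (\esum_(u in [set u | `|word_sum (@centered_step R m J Psi 0) u| <= K]%R)
     (expR (s * ws u))%:E < +oo)%E ->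
  hausdorff_measure s (recurrent_set J H F Psi) = 0%E.
Proof.
move=> s0 K0 fin.
(* The copies are indexed by a translation [k] and a prefix [u]. Neither enlarges distances, so the
   diameter bound depends on [v] alone. *)
apply: (@hausdorff_measure_limsup_eq0 R (int * seq 'I_m)%type (seq 'I_m) s _
  [set v | step_sum psi v = 0]
  (fun p v => [set z | exists2 y, y \in `[0, 1] & z = p.1%:~R + hw p.2 (hw v y)])
  (fun v => expR (ws v + E)) size s0).
- by move=> v; exact: expR_ge0.
- move=> [k u] v x y [a a01 ->] [b b01 ->] /=.
  have -> : k%:~R + hw u (hw v a) - (k%:~R + hw u (hw v b)) =
    hw u (hw v a) - hw u (hw v b) by ring.
  apply: le_trans (word_map_contract hF lambda_gt1 expand _ _ _) _.
  + exact: (word_map_itv hF).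
  + exact: (word_map_itv hF).
  have /andP[t0 t1] := theta_itv lambda_gt1.
  apply: le_trans (_ : `|hw v a - hw v b| <= _).
    by rewrite ler_piMl// exprn_ile1// ltW.
  apply: le_trans (word_upper _ a01 b01) _.
  by rewrite ler_piMr ?expR_ge0// dist_itv01.
- apply: (@le_lt_trans _ _ (\esum_(v in [set v | step_sum psi v = 0%R])
      ((expR (s * E))%:E * (expR (s * ws v))%:E))%E).
    apply: le_esum => v _; rewrite -EFinM lee_fin -expRD -expRM ler_expR; lra.
  apply: le_lt_trans (esumZl_le _ _ _) _.
  + exact: expR_ge0.
  + by move=> v; rewrite lee_fin expR_ge0.
  apply: lte_mul_pinfty; rewrite ?lee_fin ?expR_ge0//.
  apply: le_lt_trans fin; apply: esum_subset => v /= v0.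
  by rewrite (word_sum_step _ w0) v0 normr0.
- move=> e e0; have eE : 0 < e / expR E by rewrite divr_gt0// expR_gt0.
  have [N HN] := theta_small lambda_gt1 eE; exists N => v /HN.
  rewrite ltr_pdivlMr ?expR_gt0// => /ltW; apply: le_trans.
  rewrite expRD ler_wpM2r ?expR_ge0//;
    apply: le_trans (_ : expR (- ln lambda * (size v)%:R) <= _).
    by rewrite ler_expR.
  by rewrite expRM_natr expRN lnK// posrE; apply: lt_trans lambda_gt1.
- move=> x /(recurrent_returns hF hPsi lambda_gt1 expand)[k [u Hu]].
  exists (k, u) => N; have [v [v0 Nv [y y01 xy]]] := Hu N.
  by exists v; split => //; exists y.
Qed.

Local Notation block_sum s n :=
  (\sum_(t : n.-tuple 'I_m | step_sum psi t == 0) expR (s * ws t)).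

(** If all block sums at [s] were at most [B], passing to [s'] would gain the factor
    [lambda ^ (- (s' - s) * n)] on words of length [n]. The series over level 0 would then converge
    geometrically, and with it the series over all bounded levels. *)
Lemma block_sum_unbounded s s' K : s < s' -> 0 <= s' ->
  ~ (\esum_(u in [set u | `|word_sum (@centered_step R m J Psi 0) u| <= K]%R)
     (expR (s' * ws u))%:E < +oo)%E ->
  forall B, exists n, B < block_sum s n.
Proof.
move=> ss' s'0 inf B; apply: contrapT => noB; apply: inf.
have bound n : block_sum s n <= B by rewrite leNgt; apply/negP => ?;
  apply: noB; exists n.
have B0 : 0 <= B by apply: le_trans (bound 0%N); apply: sumr_ge0 => t _;
  exact: expR_ge0.
have g_ge0 u : 0 <= expR (s' * ws u) by exact: expR_ge0.
have /= := @bounded_level_sum R _ (fun u => expR (s' * ws u)) g_ge0 _ _ psi K.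
rewrite (_ : [set u | _] = [set u | `|word_sum (@centered_step R m J Psi 0) u|
  <= K]); last first.
  by apply/seteqP; split => u /=; rewrite (word_sum_step _ w0).
apply.
- by move=> u v; rewrite -expRD ler_expR -mulrDr ler_wpM2l.
- move=> v; exists (expR (s' * (ws v - 4 * E))); first exact: expR_gt0.
  by move=> u; rewrite -expRD ler_expR -mulrDr ler_wpM2l//;
    have := ws_cat_ge u v; lra.
have d0 : 0 < s' - s by rewrite subr_gt0.
have l0 : 0 < ln lambda by exact: ln_gt0.
apply: (@esum_geometric_lty _ _ _ size _ B (expR (- (s' - s) * ln lambda))) => //.
  by rewrite expR_gt0 -expR0 ltr_expR mulNr oppr_lt0 mulr_gt0.
move=> n.
apply: (@le_trans _ _ (\esum_(u in [set u | step_sum psi u = 0%R] `&` [set u |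
  size u = n])
   ((expR (- (s' - s) * ln lambda) ^+ n)%:E * (expR (s * ws u))%:E))%E).
  apply: le_esum => u [_ /= un]; rewrite -EFinM lee_fin -expRM_natr -expRD ler_expR.
  have := ws_decay u; rewrite un => dec.
  have := ler_wpM2l (ltW d0) dec; lra.
apply: le_trans (esumZl_le _ _ _) _.
- exact/exprn_ge0/expR_ge0.
- by move=> u; rewrite lee_fin expR_ge0.
rewrite [X in (_ <= X%:E)%E]mulrC EFinM; apply: lee_wpmul2l;
  first by rewrite lee_fin exprn_ge0// expR_ge0.
apply: (@le_trans _ _ (block_sum s n)%:E); last by rewrite lee_fin.
rewrite -sumEFin -(@esum_finType _ _ _ (fun t : n.-tuple 'I_m => (expR (s * ws
  t))%:E)).
  rewrite -(@esum_image _ _ _ _ val (fun u => (expR (s * ws u))%:E)).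
    apply: esum_subset => u [/= u0 /eqP un]; exists (Tuple un) => //=.
    exact/eqP.
  by move=> t t' _ _ /val_inj.
by move=> t; rewrite lee_fin expR_ge0.
Qed.

Lemma big_unique_le1 (I : finType) (P : pred I) (f : I -> R) :
  (forall a, P a -> f a <= 1) -> (forall a b, P a -> P b -> a = b) ->
  \sum_(a | P a) f a <= 1.
Proof.
move=> f1 Puniq; case: (pickP P) => [a Pa|P0]; last by rewrite big_pred0.
rewrite (big_pred1 a) ?f1// => b; apply/idP/eqP => [Pb|->//]; exact: Puniq.
Qed.

(* At most one word of a given length reaches the endpoint 0 and at most one
   reaches 1, so three words contain an inner one. *)
Lemma inner_block s n : 0 <= s -> 2 < block_sum s n ->
  exists v : n.-tuple 'I_m, step_sum psi v = 0 /\
    forall y, y \in `[0, 1] -> hw v y \in `]0, 1[.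
Proof.
move=> s0; rewrite ltNge => /negP big; apply: contrapT => noinner; apply: big.
pose hits (e : R) (t : n.-tuple 'I_m) :=
  `[< exists2 y, y \in `[0, 1] & hw t y = e >].
have hit (t : n.-tuple 'I_m) : step_sum psi t == 0 -> hits 0 t || hits 1 t.
  move=> /eqP t0; rewrite -[_ || _]negbK negb_or;
    apply/negP => /andP[/asboolP h0 /asboolP h1].
  apply: noinner; exists t; split => // y y01.
  have := word_map_itv hF t y01; rewrite !in_itv /= !lt_neqAle => /andP[-> ->].
  rewrite !andbT; apply/andP; split; apply/eqP => ty; first by apply: h0; exists y.
  by apply: h1; exists y.
have uniq e t t' : e = 0 \/ e = 1 -> hits e t -> hits e t' -> t = t'.
  move=> e01 /asboolP[a a01 ta] /asboolP[b b01 tb]; apply: val_inj.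
  apply: (word_map_endpoint_unique hF lambda_gt1 expand e01 _ a01 b01 ta tb).
  by rewrite !size_tuple.
have le1 (t : n.-tuple 'I_m) : expR (s * ws t) <= 1.
  by rewrite -expR0 ler_expR mulr_ge0_le0.
apply: (@le_trans _ _ (\sum_(t | hits 0 t) expR (s * ws t) + \sum_(t | hits 1
  t) expR (s * ws t))).
  rewrite big_mkcond [X in _ <= X + _]big_mkcond [X in _ <= _ + X]big_mkcond
    -big_split /=.
  apply: ler_sum => t _; case: ifPn => [/hit|_]; last first.
    by apply: addr_ge0; case: ifP => // _; exact: expR_ge0.
  by case: (hits 0 t); case: (hits 1 t) => //= _;
    rewrite ?addr0 ?add0r// lerDl expR_ge0.
rewrite (_ : 2 = 1 + 1)//; apply: lerD; apply: big_unique_le1 => // a b.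
  by apply: uniq; left.
by apply: uniq; right.
Qed.

Lemma uniformly_recurrent_not_null s : 0 <= s ->
  (forall B, exists n, B < block_sum s n) ->
  hausdorff_measure s (uniformly_recurrent_set J H F Psi) <> 0%E.
Proof.
move=> s0 unb.
have [n1 n1_2] := unb 2.
have [v [v0 vin]] := inner_block s0 n1_2.
(* The only word of length 0 has weight at most 1. Positive length is what makes the ratios [rho] at
   most [theta]. *)
have n1_gt0 : (0 < n1)%N.
  rewrite lt0n; apply/eqP => n10; subst n1; move: n1_2; apply/negP; rewrite -leNgt.
  apply: (@le_trans _ _ 1); last by rewrite ler1n.
  apply: big_unique_le1 => [t _|t t' _ _]; last by rewrite (tuple0 t) (tuple0 t').
  by rewrite -expR0 ler_expR mulr_ge0_le0.
have [al al0 Hal] := word_map_away_from_endpoints hF lambda_gt1 expand vin.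
(* The sum of [rho a ^ s] equals [exp (s * (ws v - 6 * E))] times the block sum; this threshold
   brings it above 1. *)
have [n2 Hn2] := unb (expR (- s * (ws v - 6 * E))).
pose P := [pred t : n2.-tuple 'I_m | step_sum psi t == 0].
pose T := 'I_#|P|.
pose rep (a : T) : n2.-tuple 'I_m := enum_val a.
have rep0 a : step_sum psi (rep a) = 0 by have := enum_valP a; rewrite inE => /eqP.
(* The trailing [v] maps [0,1] into [[al, 1 - al]], which separates the images under different
   [rep a] and keeps the orbit off the end points. *)
pose word (a : T) : seq 'I_m := rep a ++ v.
pose L := (n2 + n1)%N.
have L0 : (0 < L)%N by rewrite addn_gt0 n1_gt0 orbT.
have size_word a : size (word a) = L by rewrite size_cat !size_tuple.
have word0 a : step_sum psi (word a) = 0 by rewrite step_sum_cat rep0 v0.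
pose cc := concat word L (w0 0%N).
pose pt t := code (cc t).
have ptE t : pt t = hw (rep (t 0%N)) (hw v (pt (fun k => t k.+1))).
  rewrite /pt /cc (concat_behead _ L0 size_word) (coding_prepend hF lambda_gt1
    expand).
  by rewrite word_map_cat.
pose rho (a : T) := expR (ws (rep a) - 3 * E) * expR (ws v - 3 * E).
pose r0 := al * \big[Num.min/1]_(a : T) expR (ws (rep a) - 3 * E).
have r0_gt0 : 0 < r0.
  by rewrite mulr_gt0//; apply: lt_bigmin => // a _; exact: expR_gt0.
apply: (@hausdorff_measure_neq0 R T rho pt r0 theta s) => //.
- by have /andP[] := theta_itv lambda_gt1.
- move=> a; rewrite /rho -expRD expR_gt0/=.
  apply: le_trans (_ : expR (- ln lambda) <= _); last first.
    by rewrite expRN lnK// posrE; apply: lt_trans lambda_gt1.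
  have := ws_decay v; have := ws_le0 (rep a); rewrite size_tuple ler_expR => ra dv.
  have l0 : 0 < ln lambda by exact: ln_gt0.
  have : - ln lambda * n1%:R <= - ln lambda.
    by rewrite mulNr lerN2 ler_peMr ?ler1n// ltW.
  by move: E_ge0; lra.
- move=> a t t'; rewrite (ptE (scons a t)) (ptE (scons a t')) /= /rho -mulrA.
  apply: le_trans (word_lower _ _ _); try by apply: (word_map_itv hF);
    exact: code_itv.
  rewrite ler_wpM2l ?expR_ge0//; apply: word_lower; exact: code_itv.
- move=> t t' tt'; rewrite (ptE t) (ptE t').
  apply: le_trans (_ : expR (ws (rep (t 0%N)) - 3 * E) * al <= _).
    rewrite /r0 mulrC ler_wpM2r ?(ltW al0)//.
    exact: bigmin_le.
  apply: (word_map_gap hF lambda_gt1 expand C_ge0 log_holder w0) => //.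
  + by rewrite !size_tuple.
  + by move=> /val_inj/enum_val_inj.
  + by apply: Hal; exact: code_itv.
  + by apply: vin; exact: code_itv.
- rewrite /rho; under eq_bigr do rewrite -expRD -expRM.
  rewrite -(@big_enum_val _ _ _ _ P (fun t => expR ((ws t - 3 * E + (ws v - 3 *
    E)) * s))).
  rewrite (eq_bigr (fun t : n2.-tuple 'I_m => expR (s * (ws v - 6 * E)) * expR
    (s * ws t))); last first.
    by move=> t _; rewrite -expRD; congr expR; ring.
  rewrite -mulr_sumr mulrC -ler_pdivrMr ?expR_gt0// div1r -expRN -mulNr.
  by rewrite ltW.
- move=> _ [t _ <-]; have [M HM] :=
    step_sum_concat_bounded (w0 0%N) L0 size_word word0.
  apply: (uniformly_recurrent_coding hF hPsi lambda_gt1 expand (M := M));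
    last exact: HM.
  (* At each block boundary the remaining point is an image under [rep a] and [v], hence inner. *)
  move=> n; exists (n * L)%N; first by rewrite leq_pmulr.
  rewrite (iter_shift_concat _ _ L0) -/(pt _) ptE.
  by apply: (word_map_inner hF); apply: vin; exact: code_itv.
Qed.

End PoincareExponent.

Theorem theorem1p2 (R : realType) (m : nat) (eps : R)
    (J : 'I_m -> set R) (F : R -> R) (H : 'I_m -> R -> R) (Psi : R -> int)
    (hF : expanding_interval_map eps J F H)
    (hPsi : forall i x y, J i x -> J i y -> Psi x = Psi y) :
  exists2 K0 : R, 0 < K0 & forall K : R, K0 <= K ->
    hausdorff_dim (recurrent_set J H F Psi) =
      hausdorff_dim (uniformly_recurrent_set J H F Psi) /\
    hausdorff_dim (uniformly_recurrent_set J H F Psi) =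
      poincare_exponent J H Psi 0 K.
Proof.
have [lambda lambda_gt1 expand] := branch_expansion_rate hF.
have [C C_ge0 log_holder] := branch_log_derive_holder hF.
have w0 : nat -> 'I_m.
  by move=> _; exists 0%N; apply: leq_trans (branches_ge2 hF).
(* The two bounds below are proved for nonnegative [K], so that words of total step 0 belong to the
   series. *)
exists 1 => // K K1; have K0 : 0 <= K by lra.
have upper : (hausdorff_dim (recurrent_set J H F Psi) <= poincare_exponent J H
  Psi 0 K)%E.
  apply: le_ereal_inf => _ [s [s0 sfin] <-]; exists s => //; split => //.
  exact: (recurrent_null hF hPsi lambda_gt1 expand C_ge0 log_holder w0 s0 K0 sfin).
have lower : (poincare_exponent J H Psi 0 K <=
    hausdorff_dim (uniformly_recurrent_set J H F Psi))%E.
  apply: le_ereal_inf_tmp => _ [s [s0 snull] <-].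
  (* The slack [e] pays for the passage from a divergent series to unbounded block sums, which needs
     a strictly smaller exponent. *)
  apply/lee_addgt0Pr => e e0; rewrite -EFinD.
  apply: ereal_inf_lbound; exists (s + e) => //; split; first by lra.
  apply: contrapT => inf.
  apply: (uniformly_recurrent_not_null hF hPsi lambda_gt1 expand C_ge0
    log_holder w0 s0 _ snull).
  have se : s < s + e by rewrite ltrDl.
  have se0 : 0 <= s + e by lra.
  exact: (block_sum_unbounded hF lambda_gt1 expand C_ge0 log_holder w0 se se0 inf).
have mid := hausdorff_dim_subset (@uniformly_recurrent_sub R m J F H Psi).
have e1 : hausdorff_dim (uniformly_recurrent_set J H F Psi) =
    poincare_exponent J H Psi 0 K.
  by apply/eqP; rewrite eq_le lower (le_trans mid upper).
by split => //; apply/eqP; rewrite eq_le mid andbT e1.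
Qed.
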